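(* An element $F\in\mathrm{TAut}_2$ belongs to $\mathrm{Sol}(\widehat{KV})$ if and only if $u=\kappa(F)=(A(x,y),B(x,y))$ satisfies $x+y-\mathrm{ch}(y,x)=(1-e^{-\mathrm{ad}_x})A(x,y)+(e^{\mathrm{ad}_y}-1)B(x,y)$ and $\mathrm{div}(u)\in\tilde\delta(\mathfrak{tr}_1)$.
   Context: $k$ is a field of characteristic zero; $\mathfrak{lie}_n$, $\mathrm{Ass}_n$ are the degree completions of the free Lie and free associative algebras over $k$ on $x_1,\dots,x_n$ ($x,y$ for $n=2$); $a=a_0+\sum_k(\partial_ka)x_k$ is the unique decomposition in $\mathrm{Ass}_n$. $\mathfrak{tr}_n=\mathrm{Ass}_n^+/\langle ab-ba\rangle$ with projection $\mathrm{Tr}$; for $f\in xk[[x]]$, $\mathrm{Tr}(f(x))=\sum f_m\mathrm{Tr}(x^m)$. $\mathrm{ch}(x,y)=\ln(e^xe^y)$. $\mathfrak{tder}_2$: derivations $u$ of $\mathfrak{lie}_2$ with $u(x)=[x,a]$, $u(y)=[y,b]$, written $u=(a,b)$ (normalized: $a$ has no term $\lambda x$, $b$ no term $\lambda y$). $\mathrm{div}(u)=\mathrm{Tr}(x\partial_xa+y\partial_yb)$; derivations and automorphisms act on $\mathfrak{tr}_2$. $\tilde\delta:\mathfrak{tr}_1\to\mathfrak{tr}_2$, $\tilde\delta g=g(x)-g(\mathrm{ch}(x,y))+g(y)$. $\mathrm{TAut}_2=\{\exp(u):u\in\mathfrak{tder}_2\}$ (with $\exp(u)=\sum u^m/m!$),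 a group of automorphisms of $\mathfrak{lie}_2$. $j:\mathrm{TAut}_2\to\mathfrak{tr}_2$, $j(\exp u)=\sum_{m\ge0}\frac{u^m}{(m+1)!}\cdot\mathrm{div}(u)$. $\mathrm{Sol}(\widehat{KV})$ is the set of $F\in\mathrm{TAut}_2$ with $F(x+y)=\mathrm{ch}(x,y)$ and $j(F)\in\tilde\delta(\mathfrak{tr}_1)$. Let $l$ be the derivation of $\mathfrak{lie}_2$ with $l(x)=x$, $l(y)=y$; for $F\in\mathrm{TAut}_2$, $\kappa(F)=l-F\circ l\circ F^{-1}\in\mathfrak{tder}_2$. *)

(* Defs.v *)
(* Completed free associative algebra Ass_2 on x,y modelled as
   formal noncommutative power series: functions from words (seq bool,
   false = x, true = y) to k.  The completed free Lie algebra lie_2 is the set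
   of series all of whose homogeneous components are Lie polynomials. *)
From HB Require Import structures.
From mathcomp Require Import all_boot all_order all_algebra.
Set Implicit Arguments. Unset Strict Implicit. Unset Printing Implicit Defensive.
Import Order.TTheory GRing.Theory Num.Theory.
Local Open Scope ring_scope.

Definition word := seq bool.
Definition ser (k : fieldType) := word -> k.

Section Series.
Variable k : fieldType.
Implicit Types a b s z : ser k.

Definition mono (v : word) : ser k := fun w => (w == v)%:R.
Definition sx : ser k := mono [:: false].
Definition sy : ser k := mono [:: true].
Definition sone : ser k := mono [::].
Definition sadd a b : ser k := fun w => a w + b w.
Definition sopp a : ser k := fun w => - a w.
Definition ssub a b : ser k := sadd a (sopp b).
Definition sscale (c : k) a : ser k := fun w => c * a w.
Definition smul a b : ser k :=
  fun w => \sum_(i < (size w).+1) a (take i w) * b (drop i w).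
Definition sbr a b : ser k := ssub (smul a b) (smul b a).
Definition spow a (m : nat) : ser k := iter m (smul a) sone.
Definition seqs a b : Prop := forall w, a w = b w.
Definition hom (n : nat) a : ser k := fun w => if size w == n then a w else 0.

Inductive LiePoly : ser k -> Prop :=
| LP_x : LiePoly sx
| LP_y : LiePoly sy
| LP_add a b : LiePoly a -> LiePoly b -> LiePoly (sadd a b)
| LP_scale c a : LiePoly a -> LiePoly (sscale c a)
| LP_br a b : LiePoly a -> LiePoly b -> LiePoly (sbr a b)
| LP_ext a b : LiePoly a -> seqs a b -> LiePoly b.

Definition lie a : Prop := forall n, LiePoly (hom n a).

(* linear span of commutators (of monomials, hence of all polynomials) *)
Inductive CommSp : ser k -> Prop :=
| CS_comm (p q : word) : CommSp (ssub (mono (p ++ q)) (mono (q ++ p)))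
| CS_add a b : CommSp a -> CommSp b -> CommSp (sadd a b)
| CS_scale c a : CommSp a -> CommSp (sscale c a)
| CS_ext a b : CommSp a -> seqs a b -> CommSp b.

(* Tr a = Tr b in tr_2 : a - b lies in the (degree-)closure of the span of
   commutators *)
Definition tr_eq a b : Prop := forall n, CommSp (hom n (ssub a b)).

(* substitution of z (no constant term) in the power series sum_m c m t^m *)
Definition psub (c : nat -> k) z : ser k :=
  fun w => \sum_(m < (size w).+1) c m * spow z m w.
(* operator series sum_m c m T^m applied to a, for a degree-raising T *)
Definition opsum (c : nat -> k) (T : ser k -> ser k) a : ser k :=
  fun w => \sum_(m < (size w).+1) c m * iter m T a w.

Definition expS z : ser k := psub (fun m => (m`!%:R)^-1) z.
Definition log1p z : ser k :=
  psub (fun m => if m is 0 then 0 else (-1) ^+ m.+1 / m%:R) z.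
Definition ch (p q : ser k) : ser k := log1p (ssub (smul (expS p) (expS q)) sone).

(* the derivation u = (a,b) : x |-> [x,a], y |-> [y,b], extended to Ass_2 *)
Definition der a b (s : ser k) : ser k := fun w =>
  \sum_(i < (size w).+1) \sum_(j < (size w).+1)
    if (i <= j)%N then
      s (take i w ++ false :: drop j w) * sbr sx a (drop i (take j w))
    + s (take i w ++ true :: drop j w) * sbr sy b (drop i (take j w))
    else 0.

Definition expder a b (s : ser k) : ser k := opsum (fun m => (m`!%:R)^-1) (der a b) s.

Definition euler s : ser k := fun w => (size w)%:R * s w.

(* partial derivatives: a = a_0 + (d_x a) x + (d_y a) y *)
Definition dx a : ser k := fun w => a (rcons w false).
Definition dy a : ser k := fun w => a (rcons w true).

(* representative of div(u) = Tr(x d_x a + y d_y b) *)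
Definition divrep a b : ser k := sadd (smul sx (dx a)) (smul sy (dy b)).

(* representative of j(exp u) = sum_m u^m/(m+1)! . div(u) *)
Definition jrep a b : ser k :=
  opsum (fun m => ((m.+1)`!%:R)^-1) (der a b) (divrep a b).

(* representative of delta~ g = g(x) - g(ch(x,y)) + g(y), g in x k[[x]] *)
Definition deltat (g : nat -> k) : ser k :=
  let g' := fun m => if m is 0 then 0 else g m in
  sadd (ssub (psub g' sx) (psub g' (ch sx sy))) (psub g' sy).

Definition in_delta_img t : Prop := exists g : nat -> k, tr_eq t (deltat g).

Definition tder_norm a b : Prop :=
  lie a /\ lie b /\ a [:: false] = 0 /\ b [:: true] = 0.

Definition SolKV a0 b0 : Prop :=
  seqs (expder a0 b0 (sadd sx sy)) (ch sx sy) /\ in_delta_img (jrep a0 b0).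

(* (A,B) represents kappa(F) = l - F l F^{-1} with F = exp(a0,b0):
   agreement on the generators x, y *)
Definition kappa_rep a0 b0 A B : Prop :=
  seqs (sbr sx A)
       (ssub sx (expder a0 b0 (euler (expder (sopp a0) (sopp b0) sx)))) /\
  seqs (sbr sy B)
       (ssub sy (expder a0 b0 (euler (expder (sopp a0) (sopp b0) sy)))).

Definition c_one_minus_expneg (m : nat) : k :=
  if m is 0 then 0 else - ((-1) ^+ m / m`!%:R).
Definition c_exp_minus_one (m : nat) : k :=
  if m is 0 then 0 else (m`!%:R)^-1.

End Series.
Arguments sx {k}.
Arguments sy {k}.
Arguments sone {k}.
Arguments c_one_minus_expneg {k}.
Arguments c_exp_minus_one {k}.

(* Main.v *)
(** Write [u = der a0 b0], [F = exp u] and let [l] be the Euler derivation.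
    Expanding [e^u l e^(-u)] by iterated commutators gives
    [F l F^-1 = l - der A B] with
    [(A, B) = sum_n ad_u^n (l a0, l b0) / (n+1)!], a normalized pair of Lie
    series, and [der A B] determines this pair because
    a Lie series commuting with [x] is a multiple of [x].  Put
    [D = F l F^-1] and [c = ch(x,y)].

    First condition: [F (x+y) = c] iff [l (F^-1 c) = F^-1 c] (the degree-one
    part of [F^-1 c] is [x+y]) iff [D c = c].  As [c = log (e^x e^y)], this is
    equivalent to [D (e^x e^y) = c e^x e^y]; multiplying by [e^-x] on the left
    and [e^-y] on the right, and using [e^-x ch(x,y) e^x = ch(y,x)], one gets the
    equation for [A] and [B].

    Second condition: the divergence is a 1-cocycle, hence modulo commutators
    [div (A, B) = D (j F)].  When [D c = c] one has
    [D (delta~ g) = delta~ (t g'(t))], and [D] is injective modulo commutators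
    on series without constant term, so [j F] is in the image of [delta~] iff
    [div (A, B)] is. *)
From HB Require Import structures.
From mathcomp Require Import all_boot all_order all_algebra.
From mathcomp Require Import boolp zify ring.
Require Import Defs.
Set Implicit Arguments. Unset Strict Implicit. Unset Printing Implicit Defensive.
Import GRing.Theory.
Local Open Scope ring_scope.

(** * The algebra of noncommutative power series *)

Section Algebra.
Variable k : fieldType.
Implicit Types s t r z : ser k.

Lemma serP s t : (forall w, s w = t w) -> s = t.
Proof. exact: funext. Qed.

Lemma seqsP s t : seqs s t <-> s = t.
Proof. by split=> [/serP|->]. Qed.

HB.instance Definition _ := gen_eqMixin (ser k).
HB.instance Definition _ := gen_choiceMixin (ser k).

Fact sadd_assoc : associative (@sadd k).
Proof. by move=> s t r; apply: serP => w; apply: addrA. Qed.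
Fact sadd_comm : commutative (@sadd k).
Proof. by move=> s t; apply: serP => w; apply: addrC. Qed.
Fact sadd0s : left_id (fun=> 0) (@sadd k).
Proof. by move=> s; apply: serP => w; apply: add0r. Qed.
Fact saddNs : left_inverse (fun=> 0) (@sopp k) (@sadd k).
Proof. by move=> s; apply: serP => w; apply: addNr. Qed.
HB.instance Definition _ := GRing.isZmodule.Build (ser k)
  sadd_assoc sadd_comm sadd0s saddNs.

(* the left derivative by a letter: [s = s [::] + x * dl false s + y * dl true s] *)
Definition dl (c : bool) s : ser k := fun w => s (c :: w).

Lemma smul_nil s t : smul s t [::] = s [::] * t [::].
Proof. by rewrite /smul big_ord1. Qed.

Lemma smul_cons s t c w :
  smul s t (c :: w) = s [::] * t (c :: w) + smul (dl c s) t w.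
Proof. by rewrite /smul /= big_ord_recl. Qed.

Lemma dl_smul c s t :
  dl c (smul s t) = sadd (smul (dl c s) t) (sscale (s [::]) (dl c t)).
Proof. by apply: serP => w; rewrite /dl smul_cons addrC. Qed.

Fact smulDl : left_distributive (@smul k) (@sadd k).
Proof.
move=> s t r; apply: serP => w; rewrite /smul /sadd -big_split /=.
by apply: eq_bigr => i _; rewrite mulrDl.
Qed.
Fact smulDr : right_distributive (@smul k) (@sadd k).
Proof.
move=> s t r; apply: serP => w; rewrite /smul /sadd -big_split /=.
by apply: eq_bigr => i _; rewrite mulrDr.
Qed.
Fact sscaleAl a s t : sscale a (smul s t) = smul (sscale a s) t.
Proof.
apply: serP => w; rewrite /smul /sscale big_distrr /=.
by apply: eq_bigr => i _; rewrite mulrA.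
Qed.
Fact sscaleAr a s t : sscale a (smul s t) = smul s (sscale a t).
Proof.
apply: serP => w; rewrite /smul /sscale big_distrr /=.
by apply: eq_bigr => i _; rewrite mulrCA.
Qed.
(** Induction on the word: removing its first letter moves the claim to the shorter word with
    [dl c s] in place of [s], which avoids reindexing a double sum over cuttings. *)
Fact smulA : associative (@smul k).
Proof.
move=> s t r; apply: serP => w; elim: w s t r => [|c w IH] s t r.
  by rewrite !smul_nil mulrA.
rewrite smul_cons IH [RHS]smul_cons smul_nil dl_smul smulDl -sscaleAl /sadd.
by rewrite [in LHS]smul_cons mulrDr -addrA mulrA [in RHS](addrC (smul _ _ w)).
Qed.
Fact smul1s : left_id sone (@smul k).
Proof.
move=> s; apply: serP => -[|c w]; first by rewrite smul_nil /sone /mono mul1r.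
rewrite smul_cons /sone /mono mul1r /smul big1 ?addr0 // => i _.
by rewrite /dl /= mul0r.
Qed.
Fact smuls1 : right_id sone (@smul k).
Proof.
move=> s; apply: serP => w; elim: w s => [|c w IH] s.
  by rewrite smul_nil /sone /mono mulr1.
by rewrite smul_cons IH /sone /mono mulr0 add0r.
Qed.
Fact sone_neq0 : sone != 0 :> ser k.
Proof.
apply/eqP => /(congr1 (fun s : ser k => s [::])) /eqP.
by rewrite /sone /mono eqxx oner_eq0.
Qed.
HB.instance Definition _ := GRing.Zmodule_isNzRing.Build (ser k)
  smulA smul1s smuls1 smulDl smulDr sone_neq0.

Fact sscaleA a b s : sscale a (sscale b s) = sscale (a * b) s.
Proof. by apply: serP => w; apply: mulrA. Qed.
Fact sscale1s : left_id 1 (@sscale k).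
Proof. by move=> s; apply: serP => w; apply: mul1r. Qed.
Fact sscaleDr : right_distributive (@sscale k) +%R.
Proof. by move=> a s t; apply: serP => w; apply: mulrDr. Qed.
Fact sscaleDl s : {morph (@sscale k)^~ s : a b / a + b}.
Proof. by move=> a b; apply: serP => w; apply: mulrDl. Qed.
HB.instance Definition _ := GRing.Zmodule_isLmodule.Build k (ser k)
  sscaleA sscale1s sscaleDr sscaleDl.
HB.instance Definition _ := GRing.Lmodule_isLalgebra.Build k (ser k) sscaleAl.
HB.instance Definition _ := GRing.Lalgebra_isAlgebra.Build k (ser k) sscaleAr.

Lemma serDE s t w : (s + t) w = s w + t w. Proof. by []. Qed.
Lemma serNE s w : (- s) w = - s w. Proof. by []. Qed.
Lemma serBE s t w : (s - t) w = s w - t w. Proof. by []. Qed.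
Lemma serZE a s w : (a *: s) w = a * s w. Proof. by []. Qed.
Lemma ser_sumE (I : Type) (r : seq I) (P : pred I) (f : I -> ser k) w :
  (\sum_(i <- r | P i) f i) w = \sum_(i <- r | P i) f i w.
Proof. by elim/big_rec2: _ => // i a b _ <-. Qed.
Lemma ser1E w : (1 : ser k) w = (w == [::])%:R. Proof. by []. Qed.
Lemma ser_nilM s t : (s * t) [::] = s [::] * t [::].
Proof. exact: smul_nil. Qed.
Lemma ser_consM s t c w : (s * t) (c :: w) = s [::] * t (c :: w) + (dl c s * t) w.
Proof. exact: smul_cons. Qed.
Lemma dlM c s t : dl c (s * t) = dl c s * t + s [::] *: dl c t.
Proof. exact: dl_smul. Qed.
Lemma spowE z n : spow z n = z ^+ n.
Proof. by elim: n => // n IH; rewrite exprS -IH. Qed.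
Lemma sbrE s t : sbr s t = s * t - t * s. Proof. by []. Qed.

Fact dl_linear c : linear (dl c).
Proof. by move=> a s t; apply: serP. Qed.
HB.instance Definition _ c := GRing.isLinear.Build k (ser k) (ser k) _ (dl c) (dl_linear c).

Definition gen (c : bool) : ser k := mono k [:: c].

Lemma genM_nil c s : (gen c * s) [::] = 0.
Proof. by rewrite ser_nilM /gen /mono mul0r. Qed.
Lemma dl_gen c d : dl c (gen d) = (c == d)%:R *: 1.
Proof.
by apply: serP => w; rewrite /dl /gen /mono serZE ser1E eqseq_cons; case: (c == d); rewrite /= ?mul1r ?mul0r.
Qed.
Lemma dl_genM c d s : dl c (gen d * s) = (c == d)%:R *: s.
Proof. by rewrite dlM dl_gen /gen /mono scale0r addr0 -scalerAl mul1r. Qed.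

Lemma ser_decomp s : s = s [::] *: 1 + \sum_c gen c * dl c s.
Proof.
apply: serP => -[|c w]; rewrite serDE serZE ser1E ser_sumE /=.
  by rewrite mulr1 big1 ?addr0 // => c _; rewrite genM_nil.
have E d : (gen d * dl d s) (c :: w) = (c == d)%:R * dl d s w.
  exact: (congr1 (fun t : ser k => t w) (dl_genM c d _)).
rewrite mulr0 add0r (bigD1 c) //= big1 ?addr0 => [|d dc].
  by rewrite E eqxx mul1r.
by rewrite E eq_sym (negPf dc) mul0r.
Qed.

End Algebra.

(** * The degree filtration and summable families *)

Section Filtration.
Variable k : fieldType.
Implicit Types s t r z : ser k.

(** The decreasing degree filtration. Limit arguments go through [low_eq]: a difference lying in
    every step of the filtration vanishes. *)
Definition low n s := forall w, (size w < n)%N -> s w = 0.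

Lemma low_0s s : low 0 s. Proof. by []. Qed.
Lemma low_le m n s : (m <= n)%N -> low n s -> low m s.
Proof. by move=> mn h w hw; apply: h; apply: leq_trans mn. Qed.
Lemma lowD n s t : low n s -> low n t -> low n (s + t).
Proof. by move=> hs ht w hw; rewrite serDE hs // ht // addr0. Qed.
Lemma lowN n s : low n s -> low n (- s).
Proof. by move=> hs w hw; rewrite serNE hs // oppr0. Qed.
Lemma lowB n s t : low n s -> low n t -> low n (s - t).
Proof. by move=> hs ht; apply/lowD/lowN. Qed.
Lemma lowZ n a s : low n s -> low n (a *: s).
Proof. by move=> hs w hw; rewrite serZE hs // mulr0. Qed.
Lemma low_sum n (I : Type) (r : seq I) (P : pred I) (f : I -> ser k) :
  (forall i, P i -> low n (f i)) -> low n (\sum_(i <- r | P i) f i).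
Proof. by move=> h w hw; rewrite ser_sumE big1 // => i /h ->. Qed.
Lemma lowM m n s t : low m s -> low n t -> low (m + n) (s * t).
Proof.
move=> hs ht w hw; rewrite [LHS]/(smul s t w) /smul big1 // => i _.
have [h|h] := ltnP i m.
  by rewrite hs ?mul0r // size_takel // -ltnS.
by rewrite ht ?mulr0 // size_drop; have := ltn_ord i; lia.
Qed.
Lemma lowX z n : low 1 z -> low n (z ^+ n).
Proof.
move=> hz; elim: n => // n IH; rewrite exprS -add1n.
exact: lowM.
Qed.
Lemma low1P s : low 1 s <-> s [::] = 0.
Proof. by split=> [->//|h [|//]]. Qed.

Lemma low_eq0 s : (forall n, low n s) -> s = 0.
Proof. by move=> h; apply: serP => w; apply: (h (size w).+1). Qed.

Lemma low_eq s t : (forall n, low n (s - t)) -> s = t.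
Proof. by move=> /low_eq0/eqP; rewrite subr_eq0 => /eqP. Qed.

Definition raises d (T : ser k -> ser k) := forall n s, low n s -> low (n + d) (T s).

Lemma raises_iter T m n s : raises 1 T -> low n s -> low (m + n) (iter m T s).
Proof.
by move=> hT hs; elim: m => [//|m IH]; rewrite iterS addSn -addn1; apply: hT.
Qed.

Lemma raises_opp d T : raises d T -> raises d (fun s => - T s).
Proof. by move=> hT n s hs; apply/lowN/hT. Qed.

Lemma raises_mull z : low 1 z -> raises 1 (smul z).
Proof. by move=> hz n s hs; rewrite addnC; apply: lowM. Qed.

(** The cut at [m <= size w] makes each coefficient a finite sum. For families with [low m (f m)]
    this is the genuine infinite sum, because the omitted terms vanish at [w]. *)
Definition ssum (f : nat -> ser k) : ser k :=
  fun w => \sum_(m < (size w).+1) f m w.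

Lemma eq_ssum f g : f =1 g -> ssum f = ssum g.
Proof. by move=> /funext ->. Qed.

Lemma low_ssum n f : (forall m, low n (f m)) -> low n (ssum f).
Proof. by move=> h w hw; rewrite /ssum big1 // => i _; apply: h. Qed.

Lemma ssumD f g : ssum (fun m => f m + g m) = ssum f + ssum g.
Proof. by apply: serP => w; rewrite serDE -big_split. Qed.
Lemma ssumN f : ssum (fun m => - f m) = - ssum f.
Proof. by apply: serP => w; rewrite serNE /ssum -sumrN. Qed.
Lemma ssumB f g : ssum (fun m => f m - g m) = ssum f - ssum g.
Proof. by rewrite ssumD ssumN. Qed.
Lemma ssumZ a f : ssum (fun m => a *: f m) = a *: ssum f.
Proof. by apply: serP => w; rewrite serZE /ssum big_distrr. Qed.

Lemma ssumE f N w : (forall m, low m (f m)) -> (size w < N)%N ->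
  ssum f w = \sum_(m < N) f m w.
Proof.
move=> hf hN; rewrite /ssum (big_ord_widen N (fun m => f m w)) // [RHS](bigID (fun m : 'I_N => (m < (size w).+1)%N)) /=.
rewrite [X in _ = _ + X]big1 ?addr0 // => i; rewrite -leqNgt => hi.
exact: hf.
Qed.

Lemma ssum_low f N : (forall m, low m (f m)) -> low N (ssum f - \sum_(m < N) f m).
Proof.
by move=> hf w hw; rewrite serBE (ssumE hf hw) ser_sumE subrr.
Qed.

(** Linearity handles the partial sums; the remainders on both sides have order at least N for every
    N, since [T] does not lower degrees. *)
Lemma linear_ssum (T : {linear ser k -> ser k}) d f :
  raises d T -> (forall m, low m (f m)) -> T (ssum f) = ssum (fun m => T (f m)).
Proof.
move=> hT hf; apply: low_eq => N.
have hTf m : low m (T (f m)) by apply: low_le (hT _ _ (hf m)); rewrite leq_addr.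
have h1 : low N (T (ssum f) - \sum_(m < N) T (f m)).
  rewrite -linear_sum -linearB; apply: low_le (hT N _ (ssum_low _)) => //.
  exact: leq_addr.
rewrite -[_ - ssum _](subrKA (\sum_(m < N) T (f m))); apply: lowD => //.
by rewrite -opprB; apply/lowN/ssum_low.
Qed.

(** The coefficient at [w] sees only the triangle i + j <= size w of the double family, summed by
    rows on the left and by antidiagonals on the right. *)
Lemma ssum_ssum (f : nat -> nat -> ser k) : (forall i j, low (i + j) (f i j)) ->
  ssum (fun i => ssum (f i)) = ssum (fun n => \sum_(i < n.+1) f i (n - i)%N).
Proof.
move=> hf; apply: serP => w; rewrite {1}/ssum; set N := (size w).+1.
transitivity (\sum_(i < N) \sum_(j < N) f i j w).
  apply: eq_bigr => i _; rewrite (@ssumE _ N) // => m.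
  by apply: low_le (hf i m); rewrite leq_addl.
transitivity (\sum_(i < N) \sum_(n < N | (i <= n)%N) f i (n - i)%N w); last first.
  rewrite (exchange_big_dep predT) //= /ssum; apply: eq_bigr => n _.
  rewrite ser_sumE (big_ord_widen N (fun i => f i (n - i)%N w)) //=.
apply: eq_bigr => i _.
rewrite (bigID (fun j : 'I_N => (i + j < N)%N)) /= [X in _ + X]big1 ?addr0; last first.
  by move=> j hj; apply: hf; rewrite leqNgt.
rewrite -(big_mkord (fun j => i + j < N)%N (fun j => f i j w)).
rewrite -(big_mkord (fun n => i <= n)%N (fun n => f i (n - i)%N w)).
have hi : (i <= N)%N by apply: ltnW.
rewrite [RHS](@big_cat_nat _ _ _ i) //= [X in _ = X + _]big_nat_cond [X in _ = X + _]big1 ?add0r; last first.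
  by move=> n; lia.
rewrite (@big_cat_nat _ _ _ (N - i)) ?leq_subr //= [X in _ + X = _]big_nat_cond [X in _ + X = _]big1 ?addr0; last first.
  by move=> n; lia.
transitivity (\sum_(0 + i <= n < N | (i <= n)%N) f i (n - i)%N w); last by [].
rewrite big_addn big_nat_cond [RHS]big_nat_cond.
apply: eq_big => [n|n _]; first lia.
by rewrite addnK.
Qed.

Lemma opsumE c T s : opsum c T s = ssum (fun m => c m *: iter m T s).
Proof. by []. Qed.

Lemma psubE c z : psub c z = ssum (fun m => c m *: z ^+ m).
Proof. by apply: serP => w; apply: eq_bigr => m _; rewrite spowE. Qed.

Lemma psub_opsum c z : psub c z = opsum c (smul z) 1.
Proof. by []. Qed.

Fact iter_linear (T : {linear ser k -> ser k}) m : linear (iter m T).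
Proof.
move=> a s t; elim: m => // m IH; rewrite !iterS IH; exact: linearP.
Qed.
HB.instance Definition _ (T : {linear ser k -> ser k}) m :=
  GRing.isLinear.Build k (ser k) (ser k) _ (iter m T) (iter_linear T m).

Fact opsum_linear c (T : {linear ser k -> ser k}) : linear (opsum c T).
Proof.
move=> a s t; rewrite !opsumE -ssumZ -ssumD; apply: eq_ssum => m.
by rewrite linearP scalerDr scalerA mulrC -scalerA.
Qed.
HB.instance Definition _ c (T : {linear ser k -> ser k}) :=
  GRing.isLinear.Build k (ser k) (ser k) _ (opsum c T) (opsum_linear c T).

Lemma summable_opsum c T s : raises 1 T -> forall m, low m (c m *: iter m T s).
Proof. by move=> hT m; apply: lowZ; have := raises_iter (m := m) hT (@low_0s s); rewrite addn0. Qed.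

Lemma raises_opsum c T : raises 1 T -> raises 0 (opsum c T).
Proof.
move=> hT n s hs; rewrite opsumE addn0; apply: low_ssum => m; apply: lowZ.
by apply: low_le (raises_iter hT hs); rewrite leq_addl.
Qed.

(** The Cauchy product: series in a single operator compose like power series in one variable. *)
Lemma opsum_comp c e (T : {linear ser k -> ser k}) s : raises 1 T ->
  opsum c T (opsum e T s) =
  opsum (fun n => \sum_(i < n.+1) c i * e (n - i)%N) T s.
Proof.
move=> hT; rewrite !opsumE.
transitivity (ssum (fun i => ssum (fun j => (c i * e j) *: iter (i + j) T s))).
  apply: eq_ssum => i; rewrite (@linear_ssum _ 0); last 2 first.
  - move=> n t ht; apply: low_le (raises_iter (m := i) hT ht); lia.
  - exact: summable_opsum.
  rewrite -ssumZ; apply: eq_ssum => j.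
  by rewrite linearZ /= scalerA iterD.
rewrite ssum_ssum => [|i j]; last first.
  by apply: lowZ; have := raises_iter (m := i + j) hT (@low_0s s); rewrite addn0.
apply: eq_ssum => n; rewrite scaler_suml; apply: eq_bigr => i _.
by rewrite subnKC // -ltnS.
Qed.

Lemma iter_opp (T : {linear ser k -> ser k}) m s :
  iter m (fun t => - T t) s = (-1) ^+ m *: iter m T s.
Proof.
elim: m => [|m IH]; first by rewrite scale1r.
by rewrite !iterS IH exprS linearZ mulN1r scaleNr.
Qed.

Lemma opsum_opp c (T : {linear ser k -> ser k}) s :
  opsum c (fun t => - T t) s = opsum (fun m => c m * (-1) ^+ m) T s.
Proof. by rewrite !opsumE; apply: eq_ssum => m; rewrite iter_opp scalerA. Qed.

Lemma opsum_delta c T s : (forall m, c m = (m == 0)%:R) -> opsum c T s = s.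
Proof.
move=> hc; apply: serP => w; rewrite /opsum big_ord_recl big1 => [|i _].
  by rewrite hc mul1r addr0.
by rewrite hc mul0r.
Qed.

Lemma eq_opsum c e T s : c =1 e -> opsum c T s = opsum e T s.
Proof. by move=> /funext ->. Qed.

End Filtration.

(** Pascal's rule in summed form. It serves the alternating binomial sums, the powers of ad z and
    the iterated commutators of u with the Euler derivation. *)
Lemma pascal_sum (V : nmodType) (G : nat -> nat -> V) n :
  \sum_(r < n.+2) G r (n.+1 - r)%N *+ 'C(n.+1, r) =
  \sum_(r < n.+1) (G r.+1 (n - r)%N + G r (n - r)%N.+1) *+ 'C(n, r).
Proof.
rewrite big_ord_recl /= bin0 mulr1n subn0.
under eq_bigr do rewrite /bump /= add1n subSS binS mulrnDr.
under [RHS]eq_bigr do rewrite mulrnDl.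
rewrite !big_split /= addrA addrC; congr (_ + _).
rewrite [RHS]big_ord_recl /= bin0 mulr1n subn0; congr (_ + _).
rewrite big_ord_recr /= bin_small // addr0.
by apply: eq_bigr => i _; rewrite /bump /= add1n subnSK.
Qed.

(** * Inverse factorials in characteristic zero *)

Section Factorial.
Variables (k : fieldType) (hk : [pchar k] =i pred0).

Definition invfact n : k := (n`!%:R)^-1.

Lemma natrS_neq0 n : n.+1%:R != 0 :> k.
Proof. by rewrite (pcharf0P _).1. Qed.

Lemma fact_neq0 n : n`!%:R != 0 :> k.
Proof. by case: n`! (fact_gt0 n) => // m _; apply: natrS_neq0. Qed.

Lemma invfactS n : n.+1%:R * invfact n.+1 = invfact n.
Proof. by rewrite /invfact factS natrM invfM mulrA divff ?mul1r ?natrS_neq0. Qed.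

Lemma invfactM r n : (r <= n)%N -> invfact r * invfact (n - r) = 'C(n, r)%:R * invfact n.
Proof.
move=> hr; apply: (mulfI (fact_neq0 n)).
rewrite [RHS]mulrCA {3}/invfact divff ?fact_neq0 // mulr1.
rewrite -(bin_fact hr) !natrM -mulrA [X in _ * X]mulrACA.
by rewrite !divff ?fact_neq0 // !mulr1.
Qed.

End Factorial.

(** * Derivations *)

Section Derivations.
Variable k : fieldType.
Implicit Types a b s t r z : ser k.

Fact smul_linear z : linear (smul z).
Proof. by move=> c s t; rewrite [LHS](mulrDr z) scalerAr. Qed.
HB.instance Definition _ z :=
  GRing.isLinear.Build k (ser k) (ser k) _ (smul z) (smul_linear z).

Definition mulR z s := s * z.
Fact mulR_linear z : linear (mulR z).
Proof. by move=> c s t; rewrite /mulR mulrDl scalerAl. Qed.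
HB.instance Definition _ z :=
  GRing.isLinear.Build k (ser k) (ser k) _ (mulR z) (mulR_linear z).

Fact sbr_linear z : linear (sbr z).
Proof.
move=> c s t; rewrite !sbrE mulrDr mulrDl -scalerAr -scalerAl scalerBr.
by rewrite opprD addrACA.
Qed.
HB.instance Definition _ z :=
  GRing.isLinear.Build k (ser k) (ser k) _ (sbr z) (sbr_linear z).

Lemma low_sbr m n s t : low m s -> low n t -> low (m + n) (sbr s t).
Proof. by move=> hs ht; rewrite sbrE; apply: lowB; [|rewrite addnC]; apply: lowM. Qed.

Definition derivation (E : ser k -> ser k) :=
  linear E /\ forall s t, E (s * t) = E s * t + s * E t.

(** The difference D kills constants and letters, so D s is the sum over letters c of
    [gen k c * D (dl c s)]. Its coefficients then vanish by induction on the length of the word. *)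
Lemma derivation_eq E E' : derivation E -> derivation E' ->
  (forall c, E (gen k c) = E' (gen k c)) -> E =1 E'.
Proof.
move=> [Elin EM] [Elin' EM'] Egen.
pose D s : ser k := E s - E' s.
have Dlin (c : k) s t : D (c *: s + t) = c *: D s + D t.
  by rewrite /D Elin Elin' scalerBr opprD addrACA.
have DD s t : D (s + t) = D s + D t by rewrite -[s]scale1r Dlin !scale1r.
have DM s t : D (s * t) = D s * t + s * D t.
  by rewrite /D EM EM' mulrBl mulrBr opprD addrACA.
have D1 : D 1 = 0.
  by apply: (addrI (D 1)); rewrite addr0 -{3}[1]mulr1 DM mul1r mulr1.
have D0 (c : k) : D (c *: 1) = 0.
  have D_0 : D 0 = 0 by have := Dlin (-1) 0 0; rewrite scaler0 addr0 scaleN1r addNr.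
  by rewrite -[c *: 1]addr0 Dlin D1 D_0 scaler0 addr0.
have Dgen c : D (gen k c) = 0 by rewrite /D Egen subrr.
have Drec s : D s = \sum_c gen k c * D (dl c s).
  rewrite {1}(ser_decomp s) big_bool !DD D0 add0r !DM !Dgen !mul0r !add0r.
  by rewrite big_bool.
suff DE w s : D s w = 0.
  move=> s; apply/eqP; rewrite -subr_eq0; apply/eqP; apply: serP => w; exact: DE.
elim: w s => [|c w IH] s; rewrite Drec ser_sumE.
  by rewrite big1 // => c _; rewrite genM_nil.
rewrite big1 // => d _.
rewrite -[LHS]/(dl c (gen k d * D (dl d s)) w) dl_genM serZE.
by rewrite IH mulr0.
Qed.

Lemma derivation_comm E E' : derivation E -> derivation E' ->
  derivation (fun s => E (E' s) - E' (E s)).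
Proof.
move=> [El EM] [El' EM']; split=> [a s t|s t].
  by rewrite El' El El El' scalerBr opprD addrACA.
have addE (f : ser k -> ser k) x y : linear f -> f (x + y) = f x + f y.
  by move=> fl; rewrite -[x]scale1r fl !scale1r.
rewrite EM EM' (addE E) // (addE E') // !EM !EM' !mulrBl !mulrBr.
by apply: serP => w; rewrite !(serDE, serNE); ring.
Qed.

Lemma derivationB E E' : derivation E -> derivation E' ->
  derivation (fun s => E s - E' s).
Proof.
move=> [El EM] [El' EM']; split=> [a s t|s t].
  by rewrite El El' scalerBr opprD addrACA.
by rewrite EM EM' mulrBl mulrBr opprD addrACA.
Qed.

Lemma derivation_lin c E E' : derivation E -> derivation E' ->
  derivation (fun s => c *: E s + E' s).
Proof.
move=> [El EM] [El' EM']; split=> [a s t|s t].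
  by rewrite El El' !scalerDr !scalerA mulrC addrACA.
by rewrite EM EM' scalerDr mulrDl mulrDr scalerAl scalerAr addrACA.
Qed.

Lemma derivation_inner z : derivation (fun s => sbr s z).
Proof.
split=> [a s t|s t]; rewrite !sbrE.
  by rewrite mulrDl mulrDr scalerBr -scalerAl -scalerAr opprD addrACA.
rewrite mulrBl mulrBr !mulrA.
by apply: serP => w; rewrite !(serDE, serNE); ring.
Qed.

Lemma derivation_exp E z n : derivation E -> z * E z = E z * z ->
  E (z ^+ n.+1) = n.+1%:R *: (z ^+ n * E z).
Proof.
move=> [El EM] zE; elim: n => [|n IH]; first by rewrite !expr1 mul1r scale1r.
have zEn : z ^+ n.+1 * E z = E z * z ^+ n.+1.
  by apply/esym/commrX; apply: esym.
rewrite exprS EM IH -scalerAr mulrA -exprS -zEn.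
by rewrite -{1}[z ^+ n.+1 * E z]scale1r -scalerDl -mulrS.
Qed.

Lemma derivation_one E : derivation E -> E 1 = 0.
Proof.
by move=> [El EM]; apply: (addrI (E 1)); rewrite addr0 -{3}[1]mulr1 EM mul1r mulr1.
Qed.

Definition comp2 (c : bool) a b := if c then b else a.

(** The terms of [der a b s] with [i = 0], where a bracket replaces the first letter of a word of
    [s]. Through [der_cons] the double sum becomes a recursion on the word. *)
Definition der_head a b s := \sum_c sbr (gen k c) (comp2 c a b) * dl c s.

Lemma der_nil a b s : der a b s [::] = der_head a b s [::].
Proof.
rewrite /der big_ord1 big_ord1 /der_head /= ser_sumE big_bool !ser_nilM /= addrC.
by congr (_ + _); rewrite mulrC.
Qed.

Lemma der_cons a b s c w :
  der a b s (c :: w) = der_head a b s (c :: w) + der a b (dl c s) w.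
Proof.
rewrite {1}/der big_ord_recl; congr (_ + _).
  rewrite /der_head ser_sumE big_bool /= addrC -big_split /=.
  by apply: eq_bigr => j _; rewrite drop0 ![s _ * _]mulrC.
rewrite /der; apply: eq_bigr => i _; rewrite big_ord_recl /= add0r.
by apply: eq_bigr => j _; rewrite /bump /= !add1n.
Qed.

Lemma dl_der a b s c : dl c (der a b s) = dl c (der_head a b s) + der a b (dl c s).
Proof. by apply: serP => w; rewrite /dl der_cons. Qed.

Fact der_head_linear a b : linear (der_head a b).
Proof.
move=> c s t; rewrite /der_head scaler_sumr -big_split; apply: eq_bigr => d _ /=.
by rewrite linearP mulrDr scalerAr.
Qed.

Fact der_linear a b : linear (der a b).
Proof.
move=> c s t; apply: serP => w; elim: w s t => [|d w IH] s t.
  by rewrite serDE serZE !der_nil der_head_linear.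
rewrite serDE serZE !der_cons der_head_linear linearP IH !serDE !serZE.
by rewrite mulrDr addrACA.
Qed.
HB.instance Definition _ a b :=
  GRing.isLinear.Build k (ser k) (ser k) _ (der a b) (der_linear a b).

Lemma der_headM a b s t :
  der_head a b (s * t) = der_head a b s * t + s [::] *: der_head a b t.
Proof.
rewrite /der_head mulr_suml scaler_sumr -big_split; apply: eq_bigr => c _ /=.
by rewrite dlM mulrDr mulrA scalerAr.
Qed.

Lemma derM a b s t : der a b (s * t) = der a b s * t + s * der a b t.
Proof.
apply: serP => w; elim: w s t => [|c w IH] s t.
  by rewrite serDE !ser_nilM !der_nil der_headM serDE serZE ser_nilM.
rewrite serDE [LHS]der_cons dlM [dl c s * t + _]addrC linearP /= !(serDE, serZE) IH der_headM.
rewrite !ser_consM dl_der mulrDl !serDE serZE !ser_consM [der a b t _]der_cons der_nil.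
by rewrite addrC; ring.
Qed.

Lemma derivation_der a b : derivation (der a b).
Proof. by split; [apply: der_linear | apply: derM]. Qed.

Lemma der_gen a b c : der a b (gen k c) = sbr (gen k c) (comp2 c a b).
Proof.
have hg : der_head a b (gen k c) = sbr (gen k c) (comp2 c a b).
  rewrite /der_head (bigD1 c) //= dl_gen eqxx scale1r mulr1 big1 ?addr0 // => d dc.
  by rewrite dl_gen (negPf dc) scale0r mulr0.
apply: serP => -[|d w]; first by rewrite der_nil hg.
rewrite der_cons hg dl_gen linearZ /= (derivation_one (derivation_der a b)).
by rewrite scaler0 addr0.
Qed.

Lemma der_x a b : der a b sx = sbr sx a. Proof. exact: der_gen false. Qed.
Lemma der_y a b : der a b sy = sbr sy b. Proof. exact: der_gen true. Qed.

Lemma der_lin c a b a' b' s :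
  der (c *: a + a') (c *: b + b') s = c *: der a b s + der a' b' s.
Proof.
move: s; apply: (derivation_eq (E' := fun s => c *: der a b s + der a' b' s)).
- exact: derivation_der.
- apply: derivation_lin; exact: derivation_der.
- by case; rewrite !der_gen /comp2 linearP.
Qed.

Lemma raises_der n a b : low n a -> low n b -> raises n (der a b).
Proof.
move=> ha hb p s hs w hw; rewrite /der big1 // => i _; rewrite big1 // => j _.
case: ifP => // hij; have := ltn_ord i; have := ltn_ord j => hj hi.
have [h|h] := ltnP (size (drop i (take j w))) (1 + n).
  have lx : low 1 (sx : ser k) by apply/low1P.
  have ly : low 1 (sy : ser k) by apply/low1P.
  by rewrite (low_sbr lx ha) // (low_sbr ly hb) // !mulr0 addr0.
move: h; rewrite size_drop size_takel -1?ltnS // => h.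
by rewrite !hs ?mul0r ?addr0 // size_cat /= size_drop size_takel -1?ltnS //; lia.
Qed.

(** Both sides are derivations, so comparing them on the letters suffices. The pair on the right is
    the Lie bracket of tder_2 in coordinates. *)
Lemma der_bracket a b c d s :
  der a b (der c d s) - der c d (der a b s) =
  der (der a b c - der c d a + sbr a c) (der a b d - der c d b + sbr b d) s.
Proof.
move: s; apply: (derivation_eq (E := fun s => der a b (der c d s) - der c d (der a b s))).
- by apply: derivation_comm; apply: derivation_der.
- exact: derivation_der.
- case; rewrite !der_gen /comp2 !sbrE !linearB /= !derM !der_gen /comp2 !sbrE;
  rewrite !(mulrDl, mulrDr, mulNr, mulrN, opprD, opprK, mulrA);
  by apply: serP => w; rewrite !(serDE, serNE); ring.
Qed.

Fact euler_linear : linear (@euler k).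
Proof.
by move=> c s t; apply: serP => w; rewrite /euler !(serDE, serZE) mulrDr mulrCA.
Qed.
HB.instance Definition _ :=
  GRing.isLinear.Build k (ser k) (ser k) _ (@euler k) euler_linear.

Lemma eulerE s w : euler s w = (size w)%:R * s w. Proof. by []. Qed.

Lemma eulerM s t : euler (s * t) = euler s * t + s * euler t.
Proof.
apply: serP => w; rewrite serDE eulerE.
rewrite [(s * t) w]/(smul s t w) [(_ * t) w]/(smul _ t w) [(s * _) w]/(smul s _ w).
rewrite /smul big_distrr -big_split.
apply: eq_bigr => i _ /=; rewrite !eulerE size_drop size_takel -1?ltnS //.
have -> : (size w)%:R = i%:R + (size w - i)%:R :> k.
  by rewrite -natrD; congr (_%:R); have := ltn_ord i; lia.
by ring.
Qed.

Lemma derivation_euler : derivation (@euler k).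
Proof. by split; [apply: euler_linear | apply: eulerM]. Qed.

Lemma raises_euler : raises 0 (@euler k).
Proof. by move=> n s hs w hw; rewrite eulerE hs ?mulr0 // -(addn0 n). Qed.

Lemma euler_gen c : euler (gen k c) = gen k c.
Proof.
by apply: serP => w; rewrite eulerE /gen /mono; case: eqP => [->|]; rewrite ?mulr0 ?mulr1.
Qed.

(** The Euler derivation fixes the letters, so its commutator with a tangential derivation acts on
    the components alone. *)
Lemma euler_der a b s : euler (der a b s) - der a b (euler s) = der (euler a) (euler b) s.
Proof.
move: s; apply: (derivation_eq (E := fun s => euler (der a b s) - der a b (euler s))).
- by apply: derivation_comm; [apply: derivation_euler | apply: derivation_der].
- exact: derivation_der.
- case; rewrite euler_gen !der_gen /comp2 !sbrE !linearB /= !eulerM euler_gen;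
  by apply: serP => w; rewrite !(serDE, serNE); ring.
Qed.

(** For partial sums this is linearity in the pair. The remainder is a derivation whose pair has
    order N, hence it raises degrees by N. *)
Lemma der_ssum (A B : nat -> ser k) s :
  (forall m, low m (A m)) -> (forall m, low m (B m)) ->
  der (ssum A) (ssum B) s = ssum (fun m => der (A m) (B m) s).
Proof.
move=> hA hB; apply: low_eq => N.
have lowder m : low m (der (A m) (B m) s).
  by have := raises_der (hA m) (hB m) (@low_0s _ s).
have -> : ssum (fun m => der (A m) (B m) s) = \sum_(m < N) der (A m) (B m) s +
   (ssum (fun m => der (A m) (B m) s) - \sum_(m < N) der (A m) (B m) s).
  by rewrite addrC subrK.
rewrite opprD addrA; apply: lowB; last exact: ssum_low.
have -> : \sum_(m < N) der (A m) (B m) s = der (\sum_(m < N) A m) (\sum_(m < N) B m) s.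
  elim: N => [|N IH]; last by rewrite !big_ord_recr /= IH -[X in X + _]scale1r -der_lin !scale1r.
  rewrite !big_ord0; have := der_lin (-1) 0 0 0 0 s.
  by rewrite !scaler0 !addr0 scaleN1r addNr.
have := der_lin (-1) (\sum_(m < N) A m) (\sum_(m < N) B m) (ssum A) (ssum B) s.
rewrite !scaleN1r [RHS]addrC => <-.
rewrite ![- _ + _]addrC.
by have := raises_der (ssum_low (N := N) hA) (ssum_low (N := N) hB) (@low_0s _ s).
Qed.

Lemma derN a b s : der (- a) (- b) s = - der a b s.
Proof.
have := der_lin (-1) a b 0 0 s; rewrite !scaleN1r !addr0 => ->.
have := der_lin (-1) 0 0 0 0 s; rewrite !scaler0 !addr0 scaleN1r addNr => ->.
by rewrite addr0.
Qed.

End Derivations.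

(** * Exponentials and substitution *)

Section Exponential.
Variables (k : fieldType) (hk : [pchar k] =i pred0).
Implicit Types s t r z A B : ser k.

Let fac := @invfact k.

(** The coefficients of exp(t) exp(-t) = 1. *)
Lemma exp_convolution n :
  \sum_(i < n.+1) fac i * (fac (n - i) * (-1) ^+ (n - i)) = (n == 0)%:R.
Proof.
case: n => [|n]; first by rewrite big_ord1 mulr1 /fac /invfact invr1 mulr1.
transitivity (fac n.+1 * \sum_(i < n.+2) (-1) ^+ (n.+1 - i) *+ 'C(n.+1, i)).
  rewrite big_distrr; apply: eq_bigr => i _ /=.
  by rewrite mulrA (invfactM hk) -1?ltnS // -mulr_natl; rewrite /fac; ring.
rewrite (pascal_sum (fun _ q => (-1) ^+ q)) big1 ?mulr0 // => i _.
by rewrite exprS mulN1r subrr mul0rn.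
Qed.

Lemma exp_convolution' n :
  \sum_(i < n.+1) (fac i * (-1) ^+ i) * fac (n - i) = (n == 0)%:R.
Proof.
case: n => [|n]; first by rewrite big_ord1 /fac /invfact invr1 !mulr1.
transitivity (fac n.+1 * \sum_(i < n.+2) (-1) ^+ i *+ 'C(n.+1, i)).
  rewrite big_distrr; apply: eq_bigr => i _ /=.
  by rewrite mulrAC (invfactM hk) -1?ltnS // -mulr_natl; rewrite /fac; ring.
rewrite (pascal_sum (fun i _ => (-1) ^+ i)) big1 ?mulr0 // => i _.
by rewrite exprS mulN1r addNr mul0rn.
Qed.

(** The coefficients of exp(-t) (exp(t) - 1)/t = (1 - exp(-t))/t, obtained from the previous
    identity in degree n + 1 by splitting off its last term. *)
Lemma phi_convolution n :
  \sum_(i < n.+1) (fac i * (-1) ^+ i) * fac (n - i).+1 = fac n.+1 * (-1) ^+ n.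
Proof.
have := exp_convolution' n.+1; rewrite big_ord_recr /= subnn.
under eq_bigr => i _ do rewrite subSn -1?ltnS //.
move/eqP; rewrite addr_eq0 => /eqP ->.
by rewrite {2}/fac /invfact invr1 mulr1 exprS; ring.
Qed.

Section Operator.
Variable T : {linear ser k -> ser k}.
Hypothesis hT : raises 1 T.

Lemma opexpK s : opsum fac T (opsum fac (fun t => - T t) s) = s.
Proof.
by rewrite opsum_opp opsum_comp // opsum_delta // => m; apply: exp_convolution.
Qed.

Lemma opexpNK s : opsum fac (fun t => - T t) (opsum fac T s) = s.
Proof.
by rewrite opsum_opp opsum_comp // opsum_delta // => m; apply: exp_convolution'.
Qed.

(** Applied to div(u), this computes F^-1 (j F) as a series in -u, the form needed when F l F^-1
    acts on j F. *)
Lemma opexpN_phi s : opsum fac (fun t => - T t) (opsum (fun m => fac m.+1) T s) =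
  opsum (fun m => fac m.+1 * (-1) ^+ m) T s.
Proof.
by rewrite opsum_opp opsum_comp //; apply: eq_opsum => m; apply: phi_convolution.
Qed.
End Operator.

Lemma ssum_shift (f : nat -> ser k) : (forall m, low m (f m)) ->
  ssum f = f 0 + ssum (fun m => f m.+1).
Proof.
move=> hf; apply: serP => w; rewrite serDE {1}/ssum big_ord_recl; congr (_ + _).
by rewrite /ssum big_ord_recr /= [f _.+1 w](hf _) // addr0.
Qed.

Lemma summable_psub c z : low 1 z -> forall m, low m (c m *: z ^+ m).
Proof. by move=> hz m; apply/lowZ/lowX. Qed.

Lemma low_psub c z : low 1 z -> c 0 = 0 -> low 1 (psub c z).
Proof.
move=> hz c0; rewrite psubE; apply/low1P.
by rewrite /ssum big_ord1 serZE c0 mul0r.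
Qed.

Lemma psub_commute c z : low 1 z -> z * psub c z = psub c z * z.
Proof.
move=> hz; rewrite psubE.
rewrite [LHS](linear_ssum (T := smul z) (raises_mull hz) (summable_psub c hz)).
have hR : raises 0 (mulR z).
  by move=> n s hs; rewrite addn0; apply: low_le (lowM hs hz); rewrite leq_addr.
rewrite [RHS](linear_ssum (T := mulR z) hR (summable_psub c hz)).
apply: eq_ssum => m; rewrite [LHS]linearZ [RHS]linearZ; congr (_ *: _).
by rewrite /= /mulR -exprSr exprS.
Qed.

Lemma iter_smul z m s : iter m (smul z) s = z ^+ m * s.
Proof. by elim: m => [|m IH]; rewrite ?mul1r // exprS -mulrA -IH. Qed.

Lemma psub_mul c z s : low 1 z -> psub c z * s = opsum c (smul z) s.
Proof.
move=> hz; rewrite psubE.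
have hR : raises 0 (mulR s) by move=> n t ht; have := lowM ht (@low_0s _ s).
rewrite [LHS](linear_ssum (T := mulR s) hR (summable_psub c hz)).
by rewrite opsumE; apply: eq_ssum => m; rewrite [LHS]linearZ /= iter_smul.
Qed.

Lemma smulN z : smul (- z) = (fun t => - smul z t).
Proof. by apply: funext => t; apply: mulNr. Qed.

Lemma sbrN z : sbr (- z) = (fun t => - sbr z t).
Proof. by apply: funext => t; rewrite !sbrE mulNr mulrN opprB opprK addrC. Qed.

Lemma expS_mulN z : low 1 z -> expS z * expS (- z) = 1.
Proof.
move=> hz; rewrite [LHS]psub_mul // /expS psub_opsum smulN.
exact: (opexpK (raises_mull hz)).
Qed.

Lemma expSN_mul z : low 1 z -> expS (- z) * expS z = 1.
Proof. by move=> hz; have := expS_mulN (lowN hz); rewrite opprK. Qed.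

(** The binomial theorem for ad z, the sum of two commuting operators: left multiplication by z and
    right multiplication by -z. *)
Lemma iter_sbr z A n :
  iter n (sbr z) A = \sum_(i < n.+1) (z ^+ i * A * (- z) ^+ (n - i)) *+ 'C(n, i).
Proof.
elim: n => [|n IH]; first by rewrite big_ord1 mul1r mulr1.
rewrite iterS IH (pascal_sum (fun i q => z ^+ i * A * (- z) ^+ q)) linear_sum.
apply: eq_bigr => r _; rewrite linearMn /= sbrE; congr (_ *+ _).
by rewrite exprS exprSr !mulrA mulrN.
Qed.

Lemma exp_ad z A : low 1 z -> opsum fac (sbr z) A = expS z * A * expS (- z).
Proof.
move=> hz; have hNz := lowN hz.
rewrite -mulrA [RHS]psub_mul // /expS psubE !opsumE.
have hs : forall m, low m (fac m *: (- z) ^+ m) by exact: (summable_psub fac hNz).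
have hA : raises 0 (smul A) by move=> n s hs'; rewrite addn0 -(add0n n); apply: lowM.
have hI i : raises 0 (iter i (smul z)).
  by move=> n s hs'; apply: low_le (raises_iter (m := i) (raises_mull hz) hs'); lia.
transitivity (ssum (fun i => ssum (fun j => (fac i * fac j) *: (z ^+ i * A * (- z) ^+ j)))).
  rewrite ssum_ssum => [|i j]; last first.
    apply/lowZ/lowM; last exact: lowX.
    by have := lowM (lowX (n := i) hz) (@low_0s _ A); rewrite addn0.
  apply: eq_ssum => n; rewrite iter_sbr scaler_sumr; apply: eq_bigr => r _.
  rewrite (invfactM hk) -1?ltnS // -scaler_nat scalerA; congr (_ *: _).
  by rewrite mulrC.
apply: eq_ssum => i.
rewrite [A * _](linear_ssum (T := smul A) hA hs).
rewrite (linear_ssum (hI i)) => [|m]; last first.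
  by have := hA _ _ (hs m); rewrite addn0.
rewrite -ssumZ; apply: eq_ssum => j.
rewrite !linearZ /= scalerA iter_smul; congr (_ *: _).
  by rewrite mulrC.
by rewrite -mulrA.
Qed.

Section Conjugation.
Variables u U : ser k.
Hypotheses (uU : u * U = 1) (Uu : U * u = 1).

Lemma conj_exp z n : u * z ^+ n * U = (u * z * U) ^+ n.
Proof.
elim: n => [|n IH]; first by rewrite mulr1.
rewrite [RHS]exprS -IH exprS !mulrA; congr (_ * _ * _).
by rewrite -[u * z * U * u]mulrA Uu mulr1.
Qed.

Lemma conj_psub c z : low 1 z -> u * psub c z * U = psub c (u * z * U).
Proof.
move=> hz; rewrite !psubE.
have hu : raises 0 (smul u) by move=> n s hs; rewrite addn0; apply: (lowM (@low_0s _ u)).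
have hU : raises 0 (mulR U) by move=> n s hs; apply: (lowM hs (@low_0s _ U)).
rewrite [u * _](linear_ssum (T := smul u) hu (summable_psub c hz)).
rewrite [LHS](linear_ssum (T := mulR U) hU) => [|m]; last first.
  by have := hu _ _ (summable_psub c hz (m := m)); rewrite addn0.
apply: eq_ssum => m; rewrite !linearZ /=; congr (_ *: _).
by rewrite -conj_exp.
Qed.
End Conjugation.

(** * Derivations applied to power series in one element *)

Section DerivationSeries.
Variable D : {linear ser k -> ser k}.
Hypotheses (hD : derivation D) (lowD : raises 0 D).

Lemma derivation_psub c z : low 1 z ->
  D (psub c z) = ssum (fun m => c m *: D (z ^+ m)).
Proof.
move=> hz; rewrite psubE (linear_ssum lowD (summable_psub c hz)).
by apply: eq_ssum => m; rewrite linearZ.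
Qed.

Lemma derivation_exp_fixed z n : D z = z -> D (z ^+ n) = n%:R *: z ^+ n.
Proof.
move=> Dz; case: n => [|n]; first by rewrite scale0r (derivation_one hD).
by rewrite (derivation_exp _ hD) Dz // exprSr.
Qed.

(** The coefficients [c m * m%:R] are those of t c'(t). *)
Lemma derivation_psub_fixed c z : low 1 z -> D z = z ->
  D (psub c z) = psub (fun m => c m * m%:R) z.
Proof.
move=> hz Dz; rewrite derivation_psub // psubE; apply: eq_ssum => m.
by rewrite derivation_exp_fixed // scalerA.
Qed.

Lemma derivation_expS_fixed z : low 1 z -> D z = z -> D (expS z) = z * expS z.
Proof.
move=> hz Dz; rewrite derivation_psub_fixed // psubE ssum_shift; last exact: summable_psub.
rewrite mulr0 scale0r add0r /expS psubE.
rewrite [RHS](linear_ssum (T := smul z) (raises_mull hz) (summable_psub _ hz)).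
apply: eq_ssum => m; rewrite [RHS]linearZ /=; congr (_ *: _); last by rewrite exprS.
by rewrite mulrC (invfactS hk).
Qed.

Lemma derivation_exp_inner z A n : D z = sbr z A -> D (z ^+ n) = sbr (z ^+ n) A.
Proof.
move=> Dz; elim: n => [|n IH].
  by rewrite (derivation_one hD) sbrE mul1r mulr1 subrr.
by rewrite exprS hD.2 Dz IH (derivation_inner A).2.
Qed.

Lemma derivation_psub_inner c z A : low 1 z -> D z = sbr z A ->
  D (psub c z) = sbr (psub c z) A.
Proof.
move=> hz Dz; rewrite derivation_psub // sbrE.
have hR : raises 0 (mulR A) by move=> n s hs; apply: (lowM hs (@low_0s _ A)).
have hL : raises 0 (smul A) by move=> n s hs; rewrite addn0; apply: (lowM (@low_0s _ A)).
rewrite psubE [_ * A](linear_ssum (T := mulR A) hR (summable_psub c hz)).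
rewrite [A * _](linear_ssum (T := smul A) hL (summable_psub c hz)) -ssumB.
apply: eq_ssum => m; rewrite (derivation_exp_inner _ Dz) !linearZ sbrE /=.
by rewrite -scalerDr.
Qed.

End DerivationSeries.

End Exponential.

(** * The Campbell-Hausdorff series *)

Section Logarithm.
Variables (k : fieldType) (hk : [pchar k] =i pred0).
Implicit Types s t z v A B : ser k.

Let logc (m : nat) : k := if m is 0 then 0 else (-1) ^+ m.+1 / m%:R.

(* [pow_diff z v m] is the derivative of [z ^+ m] in the direction [v]. *)
Fixpoint pow_diff z v (m : nat) : ser k :=
  if m is m'.+1 then z * pow_diff z v m' + v * z ^+ m' else 0.

(** The derivative of log(1 + z) in the direction v, for z and v that may fail to commute. *)
Definition log_diff z v : ser k := ssum (fun m => logc m *: pow_diff z v m).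

Lemma pow_diffB z v v' m : pow_diff z (v - v') m = pow_diff z v m - pow_diff z v' m.
Proof.
elim: m => [|m IH] /=; first by rewrite subr0.
by rewrite IH mulrBr mulrBl opprD addrACA.
Qed.

Lemma log_diffB z v v' : log_diff z (v - v') = log_diff z v - log_diff z v'.
Proof.
by rewrite /log_diff -ssumB; apply: eq_ssum => m; rewrite pow_diffB scalerBr.
Qed.

Lemma low_pow_diff z v p m : low 1 z -> low p v -> low (m + p) (pow_diff z v m.+1).
Proof.
move=> hz hv; elim: m => [|m IH].
  by rewrite /= mulr0 add0r mulr1.
rewrite [pow_diff _ _ _]/(z * _ + v * z ^+ m.+1); apply: lowD.
  by rewrite addSn -add1n; apply: lowM.
by rewrite addnC; apply: lowM => //; apply: lowX.
Qed.

(* The lowest-order term of [log_diff z v] is that of [v]. *)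
Lemma log_diff_inj z v : low 1 z -> low 1 v -> log_diff z v = 0 -> v = 0.
Proof.
move=> hz hv h0; apply: low_eq0; elim=> [//|[//|p] hp] w.
rewrite ltnS leq_eqVlt => /orP [/eqP hw|]; last exact: hp.
have : log_diff z v w = 0 by rewrite h0.
rewrite /log_diff /ssum hw !big_ord_recl big1 => [|i _]; last first.
  rewrite serZE (low_pow_diff (m := i.+1) hz hp) ?mulr0 // hw; lia.
by rewrite !serZE mul0r add0r addr0 /= mulr0 add0r mulr1 -signr_odd /= divr1 mul1r.
Qed.

Lemma pow_diff_comm z v m : z * v = v * z ->
  pow_diff z v m.+1 = m.+1%:R *: (v * z ^+ m).
Proof.
move=> zv; elim: m => [|m IH]; first by rewrite /= mulr0 add0r scale1r.
rewrite [LHS]/(z * pow_diff z v m.+1 + v * z ^+ m.+1) IH -scalerAr mulrA zv.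
by rewrite -mulrA -exprS [in RHS]mulrS [RHS]scalerDl scale1r addrC.
Qed.

(** When v commutes with z the derivative is v (1 + z) times the geometric series of -z, and this
    telescopes to v. *)
Lemma log_diff_mul z v : low 1 z -> low 1 v -> z * v = v * z ->
  log_diff z (v * (1 + z)) = v.
Proof.
move=> hz hv zv.
have h1 : z * (v * (1 + z)) = v * (1 + z) * z.
  by rewrite mulrA zv -!mulrA mulrDr mulrDl mul1r mulr1.
pose g m : ser k := (-1) ^+ m *: (v * z ^+ m).
have hg m : low m.+1 (g m) by apply: lowZ; rewrite -add1n; apply: lowM => //; apply: lowX.
have E m : logc m.+1 *: pow_diff z (v * (1 + z)) m.+1 = g m - g m.+1.
  rewrite pow_diff_comm // scalerA /g /logc mulfVK ?(natrS_neq0 hk) //.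
  rewrite !exprS !mulN1r opprK scaleNr opprK -scalerDr; congr (_ *: _).
  by rewrite -mulrA mulrDl mul1r -mulrDr.
apply: serP => w; rewrite /log_diff /ssum big_ord_recl /= scale0r add0r.
under eq_bigr do rewrite /bump /= add1n E serBE.
have tele n : \sum_(i < n) (g i w - g i.+1 w) = g 0 w - g n w.
  elim: n => [|n IH]; first by rewrite big_ord0 subrr.
  by rewrite big_ord_recr /= IH addrA subrK.
(* The leftover term has order [size w + 1], so it vanishes at [w]. *)
by rewrite tele [g (size w) w](hg (size w)) // subr0 /g serZE mul1r mulr1.
Qed.

Lemma log_diffE (D : {linear ser k -> ser k}) z : derivation D -> raises 0 D ->
  low 1 z -> D (log1p z) = log_diff z (D z).
Proof.
move=> hD hD0 hz; rewrite [LHS](derivation_psub hD0) //; apply: eq_ssum => m.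
congr (_ *: _); elim: m => [|m IH]; first exact: derivation_one.
by rewrite exprS hD.2 IH addrC.
Qed.

(** Put c = log(1 + z). By [log_diffE] the left side says that [log_diff z] maps D z to c. It also
    maps c (1 + z) to c, as c commutes with z, and it is injective on series without constant
    term. *)
Lemma log_fixed (D : {linear ser k -> ser k}) z : derivation D -> raises 0 D ->
  low 1 z -> D (log1p z) = log1p z <-> D z = log1p z * (1 + z).
Proof.
move=> hD hD0 hz; have hc : low 1 (log1p z) by apply: low_psub.
have hcz : low 1 (log1p z * (1 + z)) by rewrite -[1%N]addn0; apply: lowM.
rewrite log_diffE //; split=> [h|->]; last first.
  by rewrite log_diff_mul //; apply: psub_commute.
apply/eqP; rewrite -subr_eq0; apply/eqP; apply: (log_diff_inj hz).
  by apply: lowB => //; have := hD0 _ _ hz.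
rewrite log_diffB h log_diff_mul ?subrr //; exact: psub_commute.
Qed.

End Logarithm.

(** * The equation for (A, B) as invariance of ch(x,y) *)

Section CampbellHausdorff.
Variables (k : fieldType) (hk : [pchar k] =i pred0).
Implicit Types s t z v A B : ser k.

Lemma low_gen c : low 1 (gen k c).
Proof. by apply/low1P. Qed.
Lemma low_x : low 1 (@sx k). Proof. exact: low_gen. Qed.
Lemma low_y : low 1 (@sy k). Proof. exact: low_gen. Qed.

Lemma expS_nil z : expS z [::] = 1 :> k.
Proof. by rewrite /expS /psub big_ord1 /= invr1 mulr1. Qed.

Lemma low_expM z t : low 1 (expS z * expS t - 1 : ser k).
Proof. by apply/low1P; rewrite serBE ser_nilM !expS_nil mulr1 subrr. Qed.

Lemma chE z t : ch z t = log1p (expS z * expS t - 1) :> ser k.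
Proof. by []. Qed.

Lemma low_ch z t : low 1 (ch z t : ser k).
Proof. by apply: low_psub => //; apply: low_expM. Qed.

(** Conjugation by exp(-z) turns exp(z) exp(t) into exp(t) exp(z), and it commutes with substitution
    into the logarithm. *)
Lemma ch_swap z t : low 1 z -> expS (- z) * ch z t * expS z = ch t z :> ser k.
Proof.
move=> hz; rewrite !chE /log1p conj_psub ?expSN_mul ?expS_mulN //; last exact: low_expM.
congr (psub _ _); rewrite mulrBr mulrBl mulr1 (expSN_mul hk hz) !mulrA.
by rewrite (expSN_mul hk hz) mul1r.
Qed.

(** The derivation l - (A, B). When (A, B) represents kappa(F) it is F l F^-1, by [expder_euler]. *)
Definition grade_sub A B : ser k -> ser k := @euler k \- der A B.
HB.instance Definition _ A B := GRing.Linear.on (grade_sub A B).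

Lemma derivation_grade_sub A B : derivation (grade_sub A B).
Proof.
by apply: derivationB; [apply: derivation_euler | apply: derivation_der].
Qed.

Lemma raises_grade_sub A B : raises 0 (grade_sub A B).
Proof.
move=> n s hs; apply: lowB; first by rewrite addn0; have := raises_euler hs; rewrite addn0.
exact: (raises_der (@low_0s _ A) (@low_0s _ B)).
Qed.

Lemma kv_equation A B :
  seqs (ssub (sadd sx sy) (ch sy sx))
       (sadd (opsum c_one_minus_expneg (sbr sx) A)
             (opsum c_exp_minus_one (sbr sy) B))
  <-> grade_sub A B (ch sx sy) = ch sx sy.
Proof.
rewrite seqsP.
have hx := low_x; have hy := low_y.
have -> : opsum c_one_minus_expneg (sbr sx) A = A - expS (- sx) * A * expS sx.
  have := exp_ad hk A (lowN hx); rewrite opprK => <-.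
  rewrite sbrN opsum_opp -{2}[A](opsum_delta (c := fun m => (m == 0)%:R) (sbr sx)) //.
  rewrite !opsumE -ssumB; apply: eq_ssum => m; rewrite -scalerBl; congr (_ *: _).
  case: m => [|m] /=; first by rewrite /invfact invr1 mul1r subrr.
  by rewrite sub0r mulrC.
have -> : opsum c_exp_minus_one (sbr sy) B = expS sy * B * expS (- sy) - B.
  rewrite -(exp_ad hk B hy) -{3}[B](opsum_delta (c := fun m => (m == 0)%:R) (sbr sy)) //.
  rewrite !opsumE -ssumB; apply: eq_ssum => m; rewrite -scalerBl; congr (_ *: _).
  case: m => [|m] /=; first by rewrite /invfact invr1 subrr.
  by rewrite subr0.
rewrite [ch sx sy]chE (log_fixed hk (derivation_grade_sub A B)) //;
  [ | exact: raises_grade_sub | exact: low_expM].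
have -> : 1 + (expS sx * expS sy - 1) = expS sx * expS sy :> ser k by rewrite addrC subrK.
(* Now ch(y,x) is replaced by exp(-x) ch(x,y) exp(x), so that only ch(x,y) remains. *)
rewrite -chE -(ch_swap sy hx) /=.
set D := grade_sub A B; set c := ch sx sy.
have DM : derivation D by apply: derivation_grade_sub.
have Uu := expS_mulN hk hx; have uU := expSN_mul hk hx.
have Vv := expS_mulN hk hy; have vV := expSN_mul hk hy.
have inner z C : low 1 z -> der A B z = sbr z C -> der A B (expS z) = sbr (expS z) C.
  move=> hz hC; apply: derivation_psub_inner => //; first exact: derivation_der.
  exact: (raises_der (@low_0s _ A) (@low_0s _ B)).
have eulerexp z : low 1 z -> euler z = z -> euler (expS z) = z * expS z.
  move=> hz hez; apply: derivation_expS_fixed => //; first exact: derivation_euler.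
  exact: raises_euler.
(* The factor x stands to the right of exp(x), and y below to the left of exp(y), so that
   multiplying by exp(-x) on the left and exp(-y) on the right cancels both exponentials. *)
have DU : D (expS sx) = expS sx * sx - (expS sx * A - A * expS sx).
  rewrite /D /grade_sub /= (inner _ A) ?der_x // (eulerexp _ hx) ?(euler_gen _ false) //.
  by rewrite psub_commute.
have DV : D (expS sy) = sy * expS sy - (expS sy * B - B * expS sy).
  by rewrite /D /grade_sub /= (inner _ B) ?der_y // (eulerexp _ hy) ?(euler_gen _ true).
have -> : D (expS sx * expS sy - 1) = D (expS sx * expS sy).
  by rewrite -[RHS]subr0 -(derivation_one DM); apply: linearB.
rewrite DM.2 {}DU {}DV {}/c.
move: (ch sx sy) => c.
(* Only the inverse relations between the exponentials are used from here on, so they become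
   variables. *)
move: (expS sx) (expS (- sx)) (expS sy) (expS (- sy)) Uu uU Vv vV => U u V v Uu uU Vv vV.
have cancel_eq s t : (s = t) <-> (u * s * v = u * t * v).
  split=> [->//|h]; have := congr1 (fun r => U * r * V) h.
  by rewrite /= !mulrA Uu -!mulrA vV !mulr1 !mul1r.
rewrite [X in _ <-> X]cancel_eq.
have -> : u * (c * (U * V)) * v = u * c * U by rewrite -!mulrA Vv mulr1.
have -> : u * ((U * sx - (U * A - A * U)) * V + U * (sy * V - (V * B - B * V))) * v =
  sx - (A - u * A * U) + (sy - (V * B * v - B)).
  rewrite mulrDr mulrDl; congr (_ + _).
    by rewrite -!mulrA Vv mulr1 !mulrBr !mulrA uU !mul1r.
  rewrite mulrA uU mul1r !mulrBl -!mulrA Vv !mulr1; congr (_ - (_ - _)).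
set p := u * c * U; set q := u * A * U; set r := V * B * v.
have E : sx + sy - p - (A - q + (r - B)) = sx - (A - q) + (sy - (r - B)) - p.
  by apply: serP => w; rewrite !(serDE, serNE); ring.
change (sx + sy - p = A - q + (r - B) <-> sx - (A - q) + (sy - (r - B)) = p).
by split=> /eqP; rewrite -subr_eq0; [rewrite E|rewrite -E]; rewrite subr_eq0 => /eqP.
Qed.

End CampbellHausdorff.

(** * Lie series and the trace space *)

Section Homogeneous.
Variable k : fieldType.
Implicit Types a b s t z : ser k.

Fact hom_linear n : linear (@hom k n).
Proof.
move=> c s t; apply: serP => w; rewrite serDE serZE /hom; case: ifP => // _.
by rewrite mulr0 addr0.
Qed.
HB.instance Definition _ n :=
  GRing.isLinear.Build k (ser k) (ser k) _ (@hom k n) (hom_linear n).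

Lemma hom_hom m n s : hom m (hom n s) = if m == n then hom n s else 0.
Proof.
apply: serP => w; rewrite /hom; have [->|mn] := eqVneq m n.
  by case: (size w == n).
by case: ifP => // /eqP ->; rewrite (negPf mn).
Qed.

Lemma hom_low n s : low n.+1 s -> hom n s = 0.
Proof. by move=> hs; apply: serP => w; rewrite /hom; case: eqP => // hw; rewrite hs // hw. Qed.

Lemma hom_ext s t : (forall n, hom n s = hom n t) -> s = t.
Proof.
move=> h; apply: serP => w; have := congr1 (fun s : ser k => s w) (h (size w)).
by rewrite /hom eqxx.
Qed.

Lemma low_trunc n s : low n (s - \sum_(m < n) hom m s).
Proof.
move=> w hw; rewrite serBE ser_sumE (bigD1 (Ordinal hw)) //= /hom eqxx big1 ?addr0 ?subrr //.
by move=> i hi; rewrite ifN // eq_sym; apply: contraNneq hi => hi; apply/eqP/val_inj.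
Qed.

(** Reduces a statement about the components of [T s] to finitely many homogeneous inputs, hence
    from series to polynomials. *)
Lemma hom_trunc (T : {linear ser k -> ser k}) n s : raises 0 T ->
  hom n (T s) = \sum_(m < n.+1) hom n (T (hom m s)).
Proof.
move=> hT; rewrite -!linear_sum; apply/eqP; rewrite -subr_eq0 -!linearB; apply/eqP.
by apply: hom_low; have := hT _ _ (@low_trunc n.+1 s); rewrite addn0.
Qed.

Lemma hom_ssum n (f : nat -> ser k) : (forall m, low m (f m)) ->
  hom n (ssum f) = \sum_(m < n.+1) hom n (f m).
Proof.
move=> hf; rewrite -linear_sum; apply/eqP; rewrite -subr_eq0 -linearB; apply/eqP.
exact/hom_low/ssum_low.
Qed.

Lemma homM_homE i j s t w :
  (hom i s * hom j t) w = if size w == (i + j)%N then s (take i w) * t (drop i w) else 0.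
Proof.
rewrite [LHS]/(smul (hom i s) (hom j t) w) /smul /hom; case: eqP => hw.
  have hi : (i < (size w).+1)%N by lia.
  rewrite (bigD1 (Ordinal hi)) //= size_takel ?eqxx; last by lia.
  rewrite size_drop (_ : size w - i == j)%N; last by apply/eqP; lia.
  rewrite big1 ?addr0 // => m hm.
  rewrite size_takel -1?ltnS // ifN ?mul0r //.
rewrite big1 // => m _; rewrite size_drop size_takel -1?ltnS //.
case: eqP => hm; last by rewrite mul0r.
case: eqP => hm'; last by rewrite mulr0.
by case: hw; have := ltn_ord m; lia.
Qed.

Lemma homM n s t : hom n (s * t) = \sum_(i < n.+1) hom i s * hom (n - i) t.
Proof.
apply: serP => w; rewrite ser_sumE {1}/hom; case: eqP => hw; last first.
  rewrite big1 // => i _; rewrite homM_homE ifN //.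
  by have := ltn_ord i; move/eqP: hw; lia.
rewrite [LHS]/(smul s t w) /smul hw; apply: eq_bigr => i _.
by rewrite homM_homE subnKC -1?ltnS // hw eqxx.
Qed.

Lemma homMr n s t : hom n (s * t) = \sum_(i < n.+1) hom (n - i) s * hom i t.
Proof.
rewrite homM (reindex_inj rev_ord_inj) /=; apply: eq_bigr => i _.
by rewrite subSS subKn // -ltnS.
Qed.

Lemma hom_sbr n s t : hom n (sbr s t) = \sum_(i < n.+1) sbr (hom i s) (hom (n - i) t).
Proof. by rewrite sbrE linearB /= homM homMr -sumrB. Qed.

Lemma hom_euler n s : hom n (euler s) = n%:R *: hom n s.
Proof.
apply: serP => w; rewrite serZE /hom /euler; case: eqP => [->|] //.
by rewrite mulr0.
Qed.

End Homogeneous.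

(** * Closure properties of Lie series and the centralizer of a letter *)

Section LieSeries.
Variable k : fieldType.
Implicit Types a b s t z : ser k.

Lemma LiePoly0 : LiePoly (0 : ser k).
Proof. by apply: (LP_ext (LP_scale 0 (LP_x k))) => w; rewrite /sscale mul0r. Qed.

Lemma LiePoly_sum n (f : 'I_n -> ser k) :
  (forall i, LiePoly (f i)) -> LiePoly (\sum_i f i).
Proof.
move=> hf; elim/big_rec: _ => [|i s _ hs]; first exact: LiePoly0.
exact: LP_add.
Qed.

Lemma lieD a b : lie a -> lie b -> lie (a + b).
Proof. by move=> ha hb n; rewrite linearD; apply: LP_add; [apply: ha|apply: hb]. Qed.
Lemma lieZ c a : lie a -> lie (c *: a).
Proof. by move=> ha n; rewrite linearZ; apply: LP_scale; apply: ha. Qed.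
Lemma lieB a b : lie a -> lie b -> lie (a - b).
Proof. by move=> ha hb; rewrite -scaleN1r; apply/lieD/lieZ. Qed.
Lemma lie_br a b : lie a -> lie b -> lie (sbr a b).
Proof.
move=> ha hb n; rewrite hom_sbr; apply: LiePoly_sum => i; exact: LP_br.
Qed.

Lemma gen_hom n c : hom n (gen k c) = if n == 1 then gen k c else 0.
Proof.
apply: serP => w; rewrite /hom /gen /mono; case: (n =P 1%N) => [->|hn].
  by case: w => [|d [|e w]] //=; rewrite eqseq_cons andbF.
by case: eqP => // hw; case: eqP => // wc; case: hn; rewrite -hw wc.
Qed.

Lemma LiePoly_gen c : LiePoly (gen k c).
Proof. by case: c; [apply: LP_y|apply: LP_x]. Qed.

Lemma lie_gen c : lie (gen k c).
Proof. by move=> n; rewrite gen_hom; case: ifP => _; [apply: LiePoly_gen|apply: LiePoly0]. Qed.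

(** Induction works because a component of a bracket is a sum of brackets of components, by
    [hom_sbr]. *)
Lemma LiePoly_lie a : LiePoly a -> lie a.
Proof.
elim=> {a} [||a b _ ha _ hb|c a _ ha|a b _ ha _ hb|a b _ ha /seqsP <- //].
- exact: (lie_gen false).
- exact: (lie_gen true).
- exact: lieD.
- exact: lieZ.
- exact: lie_br.
Qed.

Lemma lie_ssum (f : nat -> ser k) : (forall m, low m (f m)) ->
  (forall m, lie (f m)) -> lie (ssum f).
Proof. by move=> hl hf n; rewrite hom_ssum //; apply: LiePoly_sum => i; apply: hf. Qed.

Lemma raises0_der a b : raises 0 (der a b).
Proof. exact: raises_der (@low_0s _ a) (@low_0s _ b). Qed.

Lemma lie_der a b s : lie a -> lie b -> lie s -> lie (der a b s).
Proof.
move=> ha hb; have hP p : LiePoly p -> lie (der a b p).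
  elim=> {p} [||p q _ hp _ hq|c p _ hp|p q lp hp lq hq|p q _ hp /seqsP <- //].
  - by rewrite der_x; apply/lie_br => //; apply: (lie_gen false).
  - by rewrite der_y; apply/lie_br => //; apply: (lie_gen true).
  - by rewrite [der a b _]linearD; apply: lieD.
  - by rewrite [der a b _]linearZ; apply: lieZ.
  - suff -> : der a b (sbr p q) = sbr (der a b p) q + sbr p (der a b q).
      by apply: lieD; apply: lie_br => //; apply: LiePoly_lie.
    rewrite !sbrE linearB /= !derM.
    by apply: serP => w; rewrite !(serDE, serNE); ring.
move=> hs n; rewrite (hom_trunc _ _ (@raises0_der a b)).
by apply: LiePoly_sum => m; apply: hP.
Qed.

Lemma lie_euler a : lie a -> lie (euler a).
Proof. by move=> ha n; rewrite hom_euler; apply: LP_scale. Qed.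

Lemma LiePoly_nil a : LiePoly a -> a [::] = 0.
Proof.
elim=> {a} [||a b _ ha _ hb|c a _ ha|a b _ ha _ hb|a b _ ha /seqsP <- //] //.
- by rewrite [LHS]serDE ha hb addr0.
- by rewrite [LHS]serZE ha mulr0.
- by rewrite sbrE serBE !ser_nilM ha hb mulr0 subrr.
Qed.

Lemma low_lie a : lie a -> low 1 a.
Proof. by move=> ha; apply/low1P; have := LiePoly_nil (ha 0); rewrite /hom eqxx. Qed.

(** Restricting to powers of one letter lands in commutative power series in one variable, where
    brackets vanish; reversing the cutting index exhibits this. *)
Lemma sbr_nseq a b n c : sbr a b (nseq n c) = 0.
Proof.
rewrite sbrE serBE [(a * b) _]/(smul a b _) [(b * a) _]/(smul b a _) /smul !size_nseq.
rewrite [X in _ - X](reindex_inj rev_ord_inj) /= -sumrB big1 // => i _.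
have hi : (i <= n)%N by rewrite -ltnS.
have hi' : (n.+1 - i.+1 <= n)%N by rewrite subSS leq_subr.
by rewrite !take_nseq // !drop_nseq subSS subKn // mulrC subrr.
Qed.

Lemma LiePoly_nseq a n c : LiePoly a -> (1 < n)%N -> a (nseq n c) = 0.
Proof.
move=> h n1; elim: h => {a} [||a b _ ha _ hb|d a _ ha|a b _ _ _ _|a b _ ha /seqsP <- //].
- by case: n n1 => [|[|n]] // _; rewrite /sx /mono eqseq_cons andbF.
- by case: n n1 => [|[|n]] // _; rewrite /sy /mono eqseq_cons andbF.
- by rewrite [LHS]serDE ha hb addr0.
- by rewrite [LHS]serZE ha mulr0.
- exact: sbr_nseq.
Qed.

Lemma lie_nseq a n c : lie a -> (1 < n)%N -> a (nseq n c) = 0.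
Proof.
by move=> ha n1; have := LiePoly_nseq c (ha n) n1; rewrite /hom size_nseq eqxx.
Qed.

(* the right derivatives: [s = s [::] + dr false s * x + dr true s * y] *)
Definition dr (c : bool) s : ser k := fun w => s (rcons w c).

Fact dr_linear c : linear (dr c).
Proof. by move=> d s t; apply: serP. Qed.
HB.instance Definition _ c := GRing.isLinear.Build k (ser k) (ser k) _ (dr c) (dr_linear c).

Lemma drM c s t : dr c (s * t) = s * dr c t + t [::] *: dr c s.
Proof.
apply: serP => w; rewrite serDE serZE /dr.
rewrite [(s * t) _]/(smul s t _) [(s * _) w]/(smul s _ w) /smul size_rcons big_ord_recr /=.
congr (_ + _); last by rewrite -(size_rcons w c) take_size drop_size mulrC.
apply: eq_bigr => i _; rewrite -cats1 drop_cat take_cat.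
case: (ltnP i (size w)) => hi; first by rewrite cats1.
have -> : nat_of_ord i = size w by have := ltn_ord i; lia.
by rewrite subnn take0 cats0 take_size drop_size.
Qed.

Lemma dr_gen c d : dr c (gen k d) = (c == d)%:R *: 1.
Proof.
apply: serP => -[|e w]; rewrite /dr /gen /mono serZE ser1E /=.
  by rewrite eqseq_cons mulr1 eqxx andbT.
by rewrite mulr0 eqseq_cons; case: w => [|? ?]; rewrite andbF.
Qed.

Lemma dr_Mgen c d s : dr c (s * gen k d) = (c == d)%:R *: s.
Proof. by rewrite drM dr_gen scale0r addr0 -scalerAr mulr1. Qed.

Lemma ser_decomp_r s : s = s [::] *: 1 + \sum_c dr c s * gen k c.
Proof.
apply: serP => w; case/lastP: w => [|w c].
  rewrite serDE serZE ser1E mulr1 ser_sumE big1 ?addr0 // => c _.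
  by rewrite ser_nilM mulr0.
rewrite serDE serZE ser1E ser_sumE.
have -> : rcons w c == [::] = false by case: w.
have E d : (dr d s * gen k d) (rcons w c) = (c == d)%:R * dr d s w.
  exact: (congr1 (fun t : ser k => t w) (dr_Mgen c d _)).
rewrite mulr0 add0r (bigD1 c) //= big1 ?addr0 => [|d dc].
  by rewrite E eqxx mul1r.
by rewrite E eq_sym (negPf dc) mul0r.
Qed.

(** Coefficients of c a = a c show that moving a leading c to the end of a word keeps its
    coefficient in [a], and that words starting with another letter have coefficient 0. So [a] is
    supported on powers of c, and a Lie series has such terms in degree one only. *)
Lemma lie_centralizer c a : lie a -> a [:: c] = 0 -> sbr (gen k c) a = 0 -> a = 0.
Proof.
move=> la ac /eqP; rewrite sbrE subr_eq0 => /eqP comm.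
have E w d : a (d :: w) = (d == c)%:R * a (rcons w c).
  have := congr1 (fun s : ser k => dr c s (d :: w)) comm.
  rewrite dr_Mgen eqxx scale1r => <-.
  exact: (congr1 (fun t : ser k => t (rcons w c)) (dl_genM d c a)).
have E0 n w d : d != c -> a (nseq n c ++ d :: w) = 0.
  move=> dc; elim: n w => [|n IH] w; first by rewrite E (negPf dc) mul0r.
  by rewrite [_ ++ _]/= E eqxx mul1r rcons_cat /= IH.
(* The prefix [nseq n c] holds the letters read so far: each step lengthens it or meets a letter
   other than c. *)
suff H w n : a (nseq n c ++ w) = 0 by apply: serP => w; exact: (H w 0).
elim: w n => [|d w IH] n.
  rewrite cats0; case: n => [|[|n]] //; last exact: lie_nseq.
  exact: (low_lie la).
have [->|dc] := eqVneq d c; last exact: E0.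
by have := IH n.+1; rewrite -addn1 nseqD -catA.
Qed.

End LieSeries.

(** * The kernel of the projection Tr *)

Section Trace.
Variable k : fieldType.
Implicit Types a b s t z : ser k.

Definition Tr0 s := forall n, CommSp (hom n s).

Lemma tr_eqE s t : tr_eq s t = Tr0 (s - t).
Proof. by []. Qed.

Lemma CommSp0 : CommSp (0 : ser k).
Proof. by rewrite -(scale0r (ssub (mono k ([::] ++ [::])) (mono k ([::] ++ [::])))); apply/CS_scale/CS_comm. Qed.

Lemma CommSp_sum (I : finType) (f : I -> ser k) :
  (forall i, CommSp (f i)) -> CommSp (\sum_i f i).
Proof.
move=> hf; elim/big_rec: _ => [|i s _ hs]; first exact: CommSp0.
exact: CS_add.
Qed.

Lemma Tr0_0 : Tr0 0.
Proof. by move=> n; rewrite linear0; apply: CommSp0. Qed.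
Lemma Tr0D s t : Tr0 s -> Tr0 t -> Tr0 (s + t).
Proof. by move=> hs ht n; rewrite linearD; apply: CS_add; [apply: hs|apply: ht]. Qed.
Lemma Tr0Z c s : Tr0 s -> Tr0 (c *: s).
Proof. by move=> hs n; rewrite linearZ; apply: CS_scale; apply: hs. Qed.
Lemma Tr0N s : Tr0 s -> Tr0 (- s).
Proof. by rewrite -scaleN1r; apply: Tr0Z. Qed.
Lemma Tr0B s t : Tr0 s -> Tr0 t -> Tr0 (s - t).
Proof. by move=> hs ht; apply/Tr0D/Tr0N. Qed.
Lemma Tr0_sum (I : Type) (r : seq I) (P : pred I) (f : I -> ser k) :
  (forall i, P i -> Tr0 (f i)) -> Tr0 (\sum_(i <- r | P i) f i).
Proof.
by move=> hf; elim/big_rec: _ => [|i s Pi hs]; [apply: Tr0_0|apply: Tr0D => //; apply: hf].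
Qed.
Lemma Tr0_ssum (f : nat -> ser k) : (forall m, low m (f m)) ->
  (forall m, Tr0 (f m)) -> Tr0 (ssum f).
Proof. by move=> hl hf n; rewrite hom_ssum //; apply: CommSp_sum => i; apply: hf. Qed.

Lemma gen_mono c p : gen k c * mono k p = mono k (c :: p).
Proof.
apply: serP => -[|d w]; first by rewrite genM_nil.
have := congr1 (fun t : ser k => t w) (dl_genM d c (mono k p)).
rewrite /= /dl => ->; rewrite serZE /mono eqseq_cons; case: (d == c) => /=.
  by rewrite mul1r.
by rewrite mul0r.
Qed.

Lemma monoM p q : mono k p * mono k q = mono k (p ++ q).
Proof.
elim: p => [|c p IH]; first exact: mul1r.
by rewrite -gen_mono -mulrA IH gen_mono.
Qed.

Lemma hom_mono n s : hom n s = \sum_(v : n.-tuple bool) s v *: mono k v.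
Proof.
apply: serP => w; rewrite ser_sumE /hom; case: eqP => [hw|hw]; last first.
  rewrite big1 // => v _; rewrite serZE /mono; case: eqP => [wv|]; last by rewrite mulr0.
  by case: hw; rewrite wv size_tuple.
have hw' : size w == n by apply/eqP.
rewrite (bigD1 (Tuple hw')) //= serZE /mono eqxx mulr1 big1 ?addr0 // => v hv.
rewrite serZE (_ : w == v = false) ?mulr0 //; apply: contraNF hv => /eqP wv.
by apply/eqP/val_inj.
Qed.

(** Each component of the bracket is a finite bilinear combination of commutators of monomials. *)
Lemma Tr0_comm s t : Tr0 (sbr s t).
Proof.
move=> n; rewrite hom_sbr; apply: CommSp_sum => i.
rewrite !hom_mono sbrE mulr_suml [X in _ - X]mulr_sumr -sumrB; apply: CommSp_sum => v.
rewrite mulr_suml [X in X - _]mulr_sumr -sumrB; apply: CommSp_sum => v'.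
rewrite -!scalerAl -!scalerAr !monoM !scalerA [X in _ - X *: _]mulrC -scalerBr.
exact/CS_scale/CS_comm.
Qed.

(** By the Leibniz rule a derivation sends a commutator to a sum of two commutators, so it acts on
    tr_2. *)
Lemma Tr0_der a b s : Tr0 s -> Tr0 (der a b s).
Proof.
have hC t : CommSp t -> Tr0 (der a b t).
  elim=> {t} [p q|t1 t2 _ hs _ ht|c t _ hs|t t' _ hs /seqsP <- //].
  - suff -> : der a b (ssub (mono k (p ++ q)) (mono k (q ++ p))) =
      sbr (der a b (mono k p)) (mono k q) + sbr (mono k p) (der a b (mono k q)).
      by apply: Tr0D; apply: Tr0_comm.
    rewrite -!monoM [der a b _]linearB /= !derM !sbrE.
    by apply: serP => w; rewrite !(serDE, serNE); ring.
  - by rewrite [der a b _]linearD; apply: Tr0D.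
  - by rewrite [der a b _]linearZ; apply: Tr0Z.
move=> hs n; rewrite (hom_trunc _ _ (@raises0_der _ a b)).
by apply: CommSp_sum => m; apply: hC.
Qed.

Lemma Tr0_euler s : Tr0 s -> Tr0 (euler s).
Proof. by move=> hs n; rewrite hom_euler; apply: CS_scale. Qed.

(** In degree n + 1 the Euler derivation is multiplication by the invertible scalar n + 1. *)
Lemma Tr0_euler_inv s : [pchar k] =i pred0 -> low 1 s -> Tr0 (euler s) -> Tr0 s.
Proof.
move=> hk ls hs [|n]; first by rewrite hom_low //; apply: CommSp0.
have := CS_scale (n.+1%:R^-1) (hs n.+1); rewrite hom_euler.
rewrite [X in CommSp X](scalerA n.+1%:R^-1 n.+1%:R (hom n.+1 s)).
by rewrite mulVf ?scale1r // (natrS_neq0 hk).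
Qed.

Lemma Tr0_opsum c a b s : raises 1 (der a b) -> Tr0 s -> Tr0 (opsum c (der a b) s).
Proof.
move=> hr hs; rewrite opsumE; apply: Tr0_ssum; first exact: summable_opsum.
by move=> m; apply: Tr0Z; elim: m => // m IH; apply: Tr0_der.
Qed.

(** Beyond its linear part, a Lie polynomial is a combination of brackets, that is, of
    commutators. *)
Lemma Tr0_lie a : lie a -> low 2 a -> Tr0 a.
Proof.
have hP p : LiePoly p -> Tr0 (p - hom 1 p).
  elim=> {p} [||p q _ hp _ hq|c p _ hp|p q lp _ lq _|p q _ hp /seqsP <- //].
  - by rewrite [sx]/(gen k false) gen_hom subrr; apply: Tr0_0.
  - by rewrite [sy]/(gen k true) gen_hom subrr; apply: Tr0_0.
  - by rewrite linearD opprD addrACA; apply: Tr0D.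
  - by rewrite linearZ -scalerBr; apply: Tr0Z.
  - rewrite (@hom_low _ 1) ?subr0; first exact: Tr0_comm.
    by apply: (@low_sbr _ 1 1); apply: low_lie; apply: LiePoly_lie.
move=> la l2 n; have := hP _ (la n) n; rewrite linearB /= [X in _ - X]hom_hom.
rewrite [hom n (hom n a)]hom_hom eqxx [hom 1 (hom n a)]hom_hom.
case: ifP => [_|_]; last by rewrite subr0.
by case: eqP => [<-|_]; [rewrite hom_low // subr0|rewrite subr0].
Qed.

End Trace.

(** * Divergence and the map kappa *)

Section Divergence.
Variable k : fieldType.
Implicit Types a b s t z : ser k.

(** The chain rule for the right partial derivatives: apply D to the decomposition of [s] by last
    letters. The images of the letters have no constant term, which removes the second term of
    [drM]. *)
Lemma derivation_chain (D : {linear ser k -> ser k}) e s :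
  derivation D -> (forall c, D (gen k c) [::] = 0) ->
  dr e (D s) = D (dr e s) + \sum_c dr c s * dr e (D (gen k c)).
Proof.
move=> hD D0; rewrite {1}(ser_decomp_r s) linearD linearZ /= (derivation_one hD).
rewrite scaler0 add0r !linear_sum /=.
under eq_bigr => c _ do rewrite hD.2 linearD /= dr_Mgen drM D0 scale0r addr0.
rewrite big_split /=; congr (_ + _); rewrite (bigD1 e) //= eqxx scale1r big1 ?addr0 // => c ce.
by rewrite eq_sym (negPf ce) scale0r.
Qed.

(* the trace of the noncommutative Jacobian matrix [dr e (u (gen c))] of
   [u = der a b]; for Lie [a], [b] it differs from [divrep a b] by [a + b] *)
Definition jac_tr a b : ser k := \sum_e dr e (der a b (gen k e)).

(** The right derivative of [x, a] by x is x (dr a) - a, and similarly for y; hence the correction a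
    + b. *)
Lemma divrep_jac_tr a b : low 1 a -> low 1 b -> divrep a b = jac_tr a b + (a + b).
Proof.
move=> /low1P ha /low1P hb; rewrite /jac_tr big_bool !der_gen /= !sbrE !linearB /= !dr_Mgen !drM.
rewrite ha hb !scale0r !addr0 eqxx scale1r scale1r -[divrep a b]/(gen k false * dr false a + gen k true * dr true b).
by apply: serP => w; rewrite !(serDE, serNE); ring.
Qed.

Lemma der_gen_nil a b c : der a b (gen k c) [::] = 0.
Proof. by rewrite der_gen; exact: (sbr_nseq _ _ 0 false). Qed.

(** By the chain rule the difference consists of the diagonal entries of a commutator of two
    Jacobian matrices, and these add up to a sum of commutators of entries. *)
Lemma jac_tr_bracket a b c d :
  Tr0 (jac_tr (der a b c - der c d a + sbr a c) (der a b d - der c d b + sbr b d)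
       - (der a b (jac_tr c d) - der c d (jac_tr a b))).
Proof.
set u := der a b; set v := der c d.
have -> : jac_tr (u c - v a + sbr a c) (u d - v b + sbr b d)
       - (u (jac_tr c d) - v (jac_tr a b)) =
   \sum_e \sum_i sbr (dr i (v (gen k e))) (dr e (u (gen k i))).
  rewrite {1}/jac_tr; under eq_bigr => e _.
    rewrite -der_bracket linearB /= (derivation_chain e (v (gen k e)) (derivation_der a b)) ?der_gen_nil //;
      last by move=> i; apply: der_gen_nil.
    rewrite (derivation_chain e (u (gen k e)) (derivation_der c d)); last by move=> i; apply: der_gen_nil.
    over.
  rewrite sumrB !big_split /= -!linear_sum -/(jac_tr c d) -/(jac_tr a b) -/u -/v.
  under [RHS]eq_bigr => e _ do (under eq_bigr => i _ do rewrite sbrE; rewrite sumrB).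
  rewrite sumrB [X in _ = _ - X]exchange_big /=.
  set P := \sum_e _; set Q := \sum_e _; move: P Q => P Q; rewrite /u /v.
  by apply: serP => w; rewrite !(serDE, serNE); ring.
by apply: Tr0_sum => e _; apply: Tr0_sum => i _; apply: Tr0_comm.
Qed.

Lemma Tr0_der_lie a b s : lie a -> lie b -> lie s -> Tr0 (der a b s).
Proof.
move=> ha hb hs; apply: Tr0_lie; first exact: lie_der.
exact: (raises_der (low_lie ha) (low_lie hb) (low_lie hs)).
Qed.

(** The 1-cocycle property of the divergence. It follows from that of [jac_tr], since every
    correction term is a Lie series of order at least two or a bracket, hence has trace zero. *)
Lemma divrep_bracket a b c d : lie a -> lie b -> lie c -> lie d ->
  Tr0 (divrep (der a b c - der c d a + sbr a c) (der a b d - der c d b + sbr b d)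
       - (der a b (divrep c d) - der c d (divrep a b))).
Proof.
move=> la lb lc ld.
have Tsbr s t : Tr0 (sbr s t) by apply: Tr0_comm.
set e := der a b c - _ + _; set f := der a b d - _ + _.
have le : lie e by apply/lieD; [apply/lieB; apply/lie_der|apply/lie_br].
have lf : lie f by apply/lieD; [apply/lieB; apply/lie_der|apply/lie_br].
rewrite !divrep_jac_tr; try exact: low_lie.
have := jac_tr_bracket a b c d; rewrite -/e -/f.
have He : Tr0 (e + f).
  by apply: Tr0D; (apply: Tr0D; last exact: Tr0_comm); apply: Tr0B; apply: Tr0_der_lie.
have Hc : Tr0 (der a b (c + d)) by apply: Tr0_der_lie => //; apply: lieD.
have Ha : Tr0 (der c d (a + b)) by apply: Tr0_der_lie => //; apply: lieD.
rewrite ![der _ _ (jac_tr _ _ + _)]linearD /= => H.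
set j1 := jac_tr e f in H *; set j2 := der a b (jac_tr c d) in H *.
set j3 := der c d (jac_tr a b) in H *.
suff -> : j1 + (e + f) - (j2 + der a b (c + d) - (j3 + der c d (a + b))) =
   (j1 - (j2 - j3)) + ((e + f) - der a b (c + d) + der c d (a + b)).
  by apply: Tr0D => //; apply: Tr0D => //; apply: Tr0B.
move: (e + f) (der a b (c + d)) (der c d (a + b)) => p q r.
by apply: serP => w; rewrite !(serDE, serNE); ring.
Qed.

(** The representative of the divergence rotates the last letter of a word to the front. *)
Lemma divrep_cons a b c w : divrep a b (c :: w) = comp2 c a b (rcons w c).
Proof.
rewrite -[divrep a b]/(gen k false * dr false a + gen k true * dr true b).
rewrite -[LHS]/(dl c (gen k false * dr false a + gen k true * dr true b) w).
rewrite linearD /= !dl_genM.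
by case: c; rewrite !(serDE, serZE) /= mul0r mul1r ?addr0 ?add0r.
Qed.

Lemma divrep_nil a b : divrep a b [::] = 0.
Proof.
rewrite -[divrep a b]/(gen k false * dr false a + gen k true * dr true b).
by rewrite serDE !genM_nil addr0.
Qed.

Lemma divrep_euler a b : divrep (euler a) (euler b) = euler (divrep a b).
Proof.
apply: serP => -[|c w]; rewrite [RHS]eulerE ?divrep_nil ?mulr0 // !divrep_cons.
by case: c; rewrite /= eulerE size_rcons.
Qed.

Lemma divrepZ c a b : divrep (c *: a) (c *: b) = c *: divrep a b.
Proof.
apply: serP => -[|d w]; rewrite serZE ?divrep_nil ?mulr0 // !divrep_cons.
by case: d.
Qed.

Lemma divrep_ssum (f g : nat -> ser k) :
  divrep (ssum f) (ssum g) = ssum (fun m => divrep (f m) (g m)).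
Proof.
apply: serP => -[|c w]; first by rewrite divrep_nil /ssum big_ord1 divrep_nil.
rewrite divrep_cons /ssum; under [RHS]eq_bigr do rewrite divrep_cons.
by case: c; rewrite /= /ssum size_rcons.
Qed.

Lemma low_divrep n a b : low n a -> low n b -> low n (divrep a b).
Proof.
move=> ha hb [|c w] hw; first exact: divrep_nil.
by rewrite divrep_cons; case: c hw => hw; rewrite /= ?ha ?hb // size_rcons.
Qed.

End Divergence.

(** * Conjugation of the Euler derivation by exp(u), and the divergence of kappa(F) *)

Section Kappa.
Variables (k : fieldType) (hk : [pchar k] =i pred0) (a0 b0 : ser k).
Hypotheses (la : lie a0) (lb : lie b0).
Implicit Types s t : ser k.

Let fac := @invfact k.
Let u := der a0 b0.
Let Nu s : ser k := - u s.

Lemma raises_der_lie : raises 1 u.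
Proof. exact: raises_der (low_lie la) (low_lie lb). Qed.

Let F s := expder a0 b0 s.
Let F' s := expder (sopp a0) (sopp b0) s.

Lemma expderN_opexp s : F' s = opsum fac Nu s.
Proof.
rewrite /F' /expder (_ : der _ _ = Nu) //; apply: funext => t.
exact: derN.
Qed.

Lemma expderK s : F (F' s) = s.
Proof. by rewrite expderN_opexp; apply: (opexpK hk raises_der_lie). Qed.
Lemma expderNK s : F' (F s) = s.
Proof. by rewrite expderN_opexp; apply: (opexpNK hk raises_der_lie). Qed.

Lemma expderN_opsum s : F' s = opsum (fun m => fac m * (-1) ^+ m) u s.
Proof. by rewrite expderN_opexp; apply: opsum_opp. Qed.

(** The term u^i l (-u)^j in the expansion of exp(u) l exp(-u). *)
Definition conj_term i j s : ser k := iter i u (euler (iter j Nu s)).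

Lemma conj_term_low i j s : low (i + j) (conj_term i j s).
Proof.
have h : low j (iter j Nu s).
  by have := raises_iter (m := j) (raises_opp raises_der_lie) (@low_0s _ s); rewrite addn0.
have := raises_iter (m := i) raises_der_lie (raises_euler h).
by rewrite addn0.
Qed.

(** The coefficients [e] stay general for two uses: the exponential, giving F l F^-1, and the
    shifted exponential, giving F l F^-1 (j F). *)
Lemma expder_euler_opsum (e : nat -> k) s :
  F (euler (opsum e Nu s)) =
  ssum (fun n => \sum_(i < n.+1) (fac i * e (n - i)%N) *: conj_term i (n - i)%N s).
Proof.
have hN := raises_opp raises_der_lie.
rewrite -(ssum_ssum (f := fun i j => (fac i * e j) *: conj_term i j s)); last first.
  by move=> i j; apply/lowZ/conj_term_low.
rewrite /F /expder opsumE; apply: eq_ssum => i.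
rewrite opsumE (linear_ssum (T := @euler k) (@raises_euler k)); last exact: summable_opsum.
rewrite (linear_ssum (T := iter i u) (d := 0)); last 2 first.
- by move=> n t ht; apply: low_le (raises_iter (m := i) raises_der_lie ht); lia.
- by move=> m; have := raises_euler (summable_opsum e s hN (m := m)); rewrite addn0.
rewrite -ssumZ; apply: eq_ssum => j.
by rewrite !linearZ /= scalerA mulrC.
Qed.

(* [ad_u^n l] applied to [s] *)
Definition ad_term n s : ser k := \sum_(i < n.+1) conj_term i (n - i)%N s *+ 'C(n, i).

Lemma conj_termNr i j s : conj_term i j.+1 s = - conj_term i j (u s).
Proof.
rewrite /conj_term iterSr.
have -> : iter j Nu (Nu s) = - iter j Nu (u s).
  elim: j => [//|j IH]; rewrite !iterS IH; exact: (congr1 -%R (linearN u _)).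
by rewrite [euler _]linearN; apply: (linearN (iter i u)).
Qed.

Lemma ad_termS n s : ad_term n.+1 s = u (ad_term n s) - ad_term n (u s).
Proof.
rewrite /ad_term (pascal_sum (fun i j => conj_term i j s)) [u _]linear_sum -sumrB.
apply: eq_bigr => i _; rewrite linearMn conj_termNr -mulrnBl.
by [].
Qed.

(* the pair representing the tangential derivation [- ad_u^(n+1) l] *)
Fixpoint kappa_term n : ser k * ser k :=
  if n is m.+1 then
    let: (A, B) := kappa_term m in
    (u A - der A B a0 + sbr a0 A, u B - der A B b0 + sbr b0 B)
  else (euler a0, euler b0).

Lemma kappa_termS n : kappa_term n.+1 =
  (u (kappa_term n).1 - der (kappa_term n).1 (kappa_term n).2 a0 + sbr a0 (kappa_term n).1,
   u (kappa_term n).2 - der (kappa_term n).1 (kappa_term n).2 b0 + sbr b0 (kappa_term n).2).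
Proof. by rewrite /=; case: (kappa_term n). Qed.

Lemma lie_kappa_term n : lie (kappa_term n).1 /\ lie (kappa_term n).2.
Proof.
elim: n => [|n [hA hB]]; first by split; apply: lie_euler.
rewrite kappa_termS; split; (apply: lieD; [apply: lieB; exact: lie_der|exact: lie_br]).
Qed.

Lemma low_kappa_term n : low n.+1 (kappa_term n).1 /\ low n.+1 (kappa_term n).2.
Proof.
have l0 := low_lie la; have l1 := low_lie lb.
elim: n => [|n [hA hB]].
  by split; [have := raises_euler l0|have := raises_euler l1].
have hu s : low n.+1 s -> low n.+2 (u s) by move/raises_der_lie; rewrite addn1.
rewrite kappa_termS; split.
- apply: lowD; last exact: (low_sbr l0 hA).
  by apply: lowB; [exact: hu|exact: (raises_der hA hB l0)].
- apply: lowD; last exact: (low_sbr l1 hB).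
  by apply: lowB; [exact: hu|exact: (raises_der hA hB l1)].
Qed.

(** The base case is [u, l] = -(l a0, l b0); each further commutator with u is computed by
    [der_bracket]. *)
Lemma ad_term_kappa n s : ad_term n.+1 s = - der (kappa_term n).1 (kappa_term n).2 s.
Proof.
elim: n s => [|n IH] s.
  rewrite ad_termS /ad_term !big_ord1 /conj_term /= -euler_der.
  by rewrite opprB.
rewrite ad_termS !IH kappa_termS -der_bracket.
by rewrite [u (- _)]linearN opprB opprK addrC.
Qed.

(** The factorial is that of n + 1 because [kappa_term n] comes from the (n+1)-st commutator. *)
Definition kappaA : ser k := ssum (fun n => fac n.+1 *: (kappa_term n).1).
Definition kappaB : ser k := ssum (fun n => fac n.+1 *: (kappa_term n).2).

Lemma summable_kappaA n : low n (fac n.+1 *: (kappa_term n).1).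
Proof. by apply/lowZ/(low_le (leqnSn n)); case: (low_kappa_term n). Qed.
Lemma summable_kappaB n : low n (fac n.+1 *: (kappa_term n).2).
Proof. by apply/lowZ/(low_le (leqnSn n)); case: (low_kappa_term n). Qed.

Lemma expder_euler s : F (euler (F' s)) = grade_sub kappaA kappaB s.
Proof.
rewrite expderN_opexp expder_euler_opsum.
transitivity (ssum (fun n => fac n *: ad_term n s)).
  apply: eq_ssum => n; rewrite /ad_term scaler_sumr; apply: eq_bigr => i _.
  rewrite (invfactM hk) -1?ltnS // -scaler_nat scalerA; congr (_ *: _).
  by rewrite mulrC.
rewrite ssum_shift => [|n]; last first.
  apply/lowZ/low_sum => i _; rewrite -scaler_nat; apply: lowZ.
  have := @conj_term_low i (n - i) s.
  by rewrite subnKC // -ltnS.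
rewrite /grade_sub /=; congr (_ + _).
  by rewrite /ad_term big_ord1 /conj_term /fac /invfact /= invr1 scale1r.
rewrite (der_ssum _ summable_kappaA summable_kappaB) -ssumN; apply: eq_ssum => n.
rewrite ad_term_kappa scalerN; congr (- _).
have := der_lin (fac n.+1) (kappa_term n).1 (kappa_term n).2 0 0 s.
rewrite !addr0 => ->.
have := der_lin (-1) 0 0 0 0 s; rewrite !scaler0 !addr0 scaleN1r addNr => ->.
by rewrite addr0.
Qed.

(** The sum is the expansion of ad_u^(n+1) l without its term u^(n+1) l, with one factor -u removed
    on the right. In the induction the cocycle rule gives u applied to the previous sum plus
    ad_u^(n+1) l applied to div(u). *)
Lemma divrep_kappa_term n : Tr0 (divrep (kappa_term n).1 (kappa_term n).2 -
  \sum_(i < n.+1) conj_term i (n - i)%N (divrep a0 b0) *+ 'C(n.+1, i)).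
Proof.
set d := divrep a0 b0; elim: n => [|n IH].
  by rewrite big_ord1 /conj_term /= divrep_euler bin0 subrr; apply: Tr0_0.
have [hA hB] := lie_kappa_term n.
have H := divrep_bracket la lb hA hB.
rewrite kappa_termS /=.
(* Pascal's rule for ['C(n.+2, i)]: one summand gives [ad_term n.+1 d], the other, shifted by one in
   i, the image under u. *)
have -> : \sum_(i < n.+2) conj_term i (n.+1 - i)%N d *+ 'C(n.+2, i) =
  u (\sum_(i < n.+1) conj_term i (n - i)%N d *+ 'C(n.+1, i)) + ad_term n.+1 d.
  rewrite /ad_term big_ord_recl [X in _ = _ + X]big_ord_recl !bin0 addrCA; congr (_ + _).
  rewrite [u _]linear_sum -big_split /=; apply: eq_bigr => i _.
  by rewrite /bump /= add1n binS subSS mulrnDr addrC linearMn.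
rewrite ad_term_kappa.
have := Tr0D H (Tr0_der a0 b0 IH).
congr Tr0; rewrite [der a0 b0 (_ - _)]linearB /= -/u.
by apply: serP => w; rewrite !(serDE, serNE); ring.
Qed.

(** Both sides expand into [conj_term]s of div(u), and the weights match because 1/(i! (n+1-i)!) is
    the binomial coefficient of n + 1 over i divided by (n+1)!. *)
Lemma divrep_kappa : Tr0 (divrep kappaA kappaB - grade_sub kappaA kappaB (jrep a0 b0)).
Proof.
rewrite -expder_euler expderN_opexp (opexpN_phi hk raises_der_lie).
rewrite -[opsum _ (der a0 b0) _]opsum_opp expder_euler_opsum divrep_ssum -ssumB.
have E n : \sum_(i < n.+1) (fac i * fac (n - i).+1) *: conj_term i (n - i) (divrep a0 b0) =
  fac n.+1 *: \sum_(i < n.+1) conj_term i (n - i)%N (divrep a0 b0) *+ 'C(n.+1, i).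
  rewrite scaler_sumr; apply: eq_bigr => i _.
  have hi : (i <= n)%N by rewrite -ltnS.
  rewrite -subSn // (invfactM hk) ?leqW // -scaler_nat scalerA; congr (_ *: _).
  by rewrite mulrC.
apply: Tr0_ssum => n; rewrite E divrepZ -scalerBr; last exact/Tr0Z/divrep_kappa_term.
apply/lowZ/lowB.
  case: (low_kappa_term n) => hA hB; apply: low_divrep; exact: low_le (leqnSn n) _.
apply: low_sum => i _; rewrite -scaler_nat; apply: lowZ.
by have := @conj_term_low i (n - i) (divrep a0 b0); rewrite subnKC // -ltnS.
Qed.

End Kappa.

(** * Comparison of the two conditions *)

Section KashiwaraVergne.
Variables (k : fieldType) (hk : [pchar k] =i pred0).
Implicit Types s t A B : ser k.

Lemma deltatE g : deltat g = psub (fun m => if m is 0 then 0 else g m) sx -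
  psub (fun m => if m is 0 then 0 else g m) (ch sx sy) +
  psub (fun m => if m is 0 then 0 else g m) sy :> ser k.
Proof. by []. Qed.

Lemma low_deltat g : low 1 (deltat g : ser k).
Proof.
rewrite deltatE; apply: lowD; first apply: lowB; apply: low_psub => //;
  [exact: low_x|exact: low_ch|exact: low_y].
Qed.

Lemma eq_deltat g h : (forall m, g m.+1 = h m.+1) -> deltat g = deltat h :> ser k.
Proof.
move=> gh; rewrite !deltatE (_ : (fun m => _) = (fun m => if m is 0 then 0 else h m)) //.
by apply: funext => -[].
Qed.

(** On g(x) and g(y) the tangential part is a commutator, so only the Euler part survives in the
    trace; on g(ch(x,y)) the hypothesis gives t g'(t) exactly. *)
Lemma grade_sub_deltat A B g : grade_sub A B (ch sx sy) = ch sx sy ->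
  Tr0 (grade_sub A B (deltat g) - deltat (fun m => g m * m%:R)).
Proof.
move=> hc; pose g' m : k := if m is 0 then 0 else g m.
have hg : (fun m => if m is 0 then 0 else g m * m%:R) = (fun m => g' m * m%:R) :> (nat -> k).
  by apply: funext => -[|m] //=; rewrite mul0r.
rewrite !deltatE hg -/g' -/(psub g' _).
have hgen c C : der A B (gen k c) = sbr (gen k c) C ->
    Tr0 (grade_sub A B (psub g' (gen k c)) - psub (fun m => g' m * m%:R) (gen k c)).
  move=> hC; have lc := @low_gen k c.
  rewrite /grade_sub /= (derivation_psub_fixed (derivation_euler k) (@raises_euler k) _ lc (euler_gen _ c)).
  rewrite (derivation_psub_inner (derivation_der A B) (@raises0_der _ A B) _ lc hC).
  by rewrite addrAC subrr sub0r; apply/Tr0N/Tr0_comm.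
have Hx := hgen false A (der_x A B); have Hy := hgen true B (der_y A B).
have Hc := derivation_psub_fixed (derivation_grade_sub A B) (@raises_grade_sub _ A B) g' (@low_ch k sx sy) hc.
rewrite linearD linearB /= [X in _ - X + _]Hc.
have := Tr0D Hx Hy; congr Tr0.
by apply: serP => w; rewrite !(serDE, serNE); ring.
Qed.

Lemma Tr0_grade_sub A B s : Tr0 s -> Tr0 (grade_sub A B s).
Proof. by move=> hs; apply: Tr0B; [apply: Tr0_euler|apply: Tr0_der]. Qed.

Lemma ch_linear_part : hom 1 (ch sx sy) = sx + sy :> ser k.
Proof.
have hgen c e : expS (gen k c) [:: e] = (e == c)%:R.
  rewrite /expS psubE /ssum !big_ord_recl big_ord0 addr0 !serZE expr1.
  rewrite [X in _ * X + _]ser1E mulr0 add0r invr1 mul1r /gen /mono.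
  by rewrite eqseq_cons andbT.
apply: serP => w; rewrite /hom; case: eqP => [|hw]; last first.
  rewrite serDE /sx /sy /mono.
  by case: eqP => [wx|_]; [case: hw; rewrite wx|case: eqP => [wy|_]; [case: hw; rewrite wy|rewrite addr0]].
case: w => [|e [|]] // _.
rewrite chE /log1p psubE /ssum !big_ord_recl big_ord0 addr0 !serZE mul0r add0r expr1 /=.
rewrite serBE [X in _ * (_ - X)]ser1E subr0 -signr_odd /= divr1 mul1r ser_consM expS_nil mul1r.
rewrite ser_nilM expS_nil mulr1 /dl (hgen false) (hgen true) serDE /sx /sy /mono !eqseq_cons !andbT.
by rewrite addrC.
Qed.

Variables (a0 b0 : ser k).
Hypotheses (la : lie a0) (lb : lie b0).

Let F s := expder a0 b0 s.
Let F' s := expder (sopp a0) (sopp b0) s.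
Let KA := kappaA a0 b0.
Let KB := kappaB a0 b0.

Lemma tder_norm_kappa : a0 [:: false] = 0 -> b0 [:: true] = 0 -> tder_norm KA KB.
Proof.
move=> ha hb; have lAB := lie_kappa_term la lb; have lowAB := low_kappa_term la lb.
split; [|split; [|split]].
- apply: lie_ssum; first exact: summable_kappaA.
  by move=> n; apply: lieZ; case: (lAB n).
- apply: lie_ssum; first exact: summable_kappaB.
  by move=> n; apply: lieZ; case: (lAB n).
- rewrite /KA /kappaA /ssum !big_ord_recl big_ord0 !serZE addr0.
  by rewrite [X in _ + _ * X](lowAB 1).1 // mulr0 addr0 /= eulerE ha !mulr0.
- rewrite /KB /kappaB /ssum !big_ord_recl big_ord0 !serZE addr0.
  by rewrite [X in _ + _ * X](lowAB 1).2 // mulr0 addr0 /= eulerE hb !mulr0.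
Qed.

Lemma kappa_repE A B : kappa_rep a0 b0 A B <-> sbr sx A = sbr sx KA /\ sbr sy B = sbr sy KB.
Proof.
have E c : gen k c - F (euler (F' (gen k c))) = sbr (gen k c) (comp2 c KA KB).
  rewrite /F /F' (expder_euler hk la lb) /grade_sub /= euler_gen der_gen.
  by rewrite opprB addrC subrK.
rewrite /kappa_rep !seqsP -[ssub sx _]/(gen k false - F (euler (F' (gen k false)))).
by rewrite -[ssub sy _]/(gen k true - F (euler (F' (gen k true)))) !E.
Qed.

Lemma kappa_unique A B : a0 [:: false] = 0 -> b0 [:: true] = 0 -> tder_norm A B -> kappa_rep a0 b0 A B ->
  A = KA /\ B = KB.
Proof.
move=> ha hb [lA [lB [hA hB]]] /kappa_repE [eA eB].
have [lKA [lKB [hKA hKB]]] := tder_norm_kappa ha hb.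
split; apply/eqP; rewrite -subr_eq0; apply/eqP.
- apply: (lie_centralizer (c := false)); first exact: lieB.
    by rewrite serBE hA hKA subrr.
  by rewrite linearB /=; apply/eqP; rewrite subr_eq0; apply/eqP.
- apply: (lie_centralizer (c := true)); first exact: lieB.
    by rewrite serBE hB hKB subrr.
  by rewrite linearB /=; apply/eqP; rewrite subr_eq0; apply/eqP.
Qed.

Lemma expder_fixed : F (sx + sy) = ch sx sy <-> grade_sub KA KB (ch sx sy) = ch sx sy.
Proof.
rewrite -(expder_euler hk la lb) -/(F' _) -/(F _); split=> [<-|h].
  rewrite [F' _](expderNK hk la lb); congr F.
  by rewrite linearD /= (euler_gen k false) (euler_gen k true).
(* F^-1 (ch(x,y)) is an eigenvector of l for the eigenvalue 1. The rest identifies it degree by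
   degree. *)
have e1 : euler (F' (ch sx sy)) = F' (ch sx sy) by rewrite -{2}h [RHS](expderNK hk la lb).
have r1 := raises_der_lie la lb.
suff <- : F' (ch sx sy) = sx + sy by rewrite [LHS](expderK hk la lb).
rewrite -ch_linear_part; apply: hom_ext => n; rewrite hom_hom.
case: eqP => [->|n1].
  (* In degree one F^-1 is the identity on series without constant term, since u raises degrees. *)
  have -> : F' (ch sx sy) = ch sx sy + (F' (ch sx sy) - ch sx sy) by rewrite addrC subrK.
  rewrite linearD /= [X in _ + X]hom_low ?addr0 //.
  rewrite [F' _](expderN_opsum a0 b0) opsumE ssum_shift; last exact: (summable_opsum _ _ r1).
  rewrite /= mulr1 /invfact invr1 scale1r addrAC subrr add0r.
  apply: low_ssum => m; apply: lowZ.
  by apply: low_le (raises_iter (m := m.+1) r1 (@low_ch k sx sy)); lia.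
(* In degree n the component is killed by n - 1, which is -1 for n = 0 and a positive integer for n
   >= 2. *)
have := congr1 (hom n) e1; rewrite hom_euler => /eqP.
rewrite -subr_eq0 -{2}[hom n _]scale1r -scalerBl scaler_eq0 => /orP [|/eqP //].
case: n n1 => [|[|n]] // _; first by rewrite sub0r oppr_eq0 oner_eq0.
by rewrite mulrS addrAC subrr add0r (negPf (natrS_neq0 hk _)).
Qed.

Lemma low_jrep : low 1 (jrep a0 b0).
Proof.
by apply/low1P; rewrite /jrep /opsum big_ord1 [X in _ * X]divrep_nil mulr0.
Qed.

Lemma Tr0_expder s : Tr0 s -> Tr0 (F s).
Proof. by apply: Tr0_opsum; apply: raises_der_lie. Qed.

Lemma Tr0_expderN s : Tr0 s -> Tr0 (F' s).
Proof. by rewrite [F' _](expderN_opsum a0 b0); apply: Tr0_opsum; apply: raises_der_lie. Qed.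

(** The operator is F l F^-1: F and F^-1 preserve trace zero, and l is injective modulo commutators
    on series without constant term. *)
Lemma Tr0_grade_sub_inv s : low 1 s -> Tr0 (grade_sub KA KB s) -> Tr0 s.
Proof.
move=> ls; rewrite -(expder_euler hk la lb) => /Tr0_expderN.
rewrite [F' _](expderNK hk la lb) => h.
rewrite -(expderK hk la lb s); apply: Tr0_expder; apply: (Tr0_euler_inv hk) => //.
rewrite (expderN_opsum a0 b0); have := raises_opsum (fun m => invfact k m * (-1) ^+ m) (raises_der_lie la lb) ls.
by rewrite addn0.
Qed.

Lemma in_delta_img_kappa : grade_sub KA KB (ch sx sy) = ch sx sy ->
  in_delta_img (jrep a0 b0) <-> in_delta_img (divrep KA KB).
Proof.
move=> hc; have hdiv := divrep_kappa hk la lb.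
split=> [[g]|[h]]; rewrite tr_eqE => H.
  (* The new witness is t g'(t). *)
  exists (fun m => g m * m%:R); rewrite tr_eqE.
  have := Tr0D (Tr0D hdiv (Tr0_grade_sub KA KB H)) (grade_sub_deltat g hc).
  congr Tr0; rewrite [grade_sub _ _ (_ - _)]linearB /=; rewrite -/KA -/KB.
  by apply: serP => w; rewrite !(serDE, serNE); ring.
(* This solves t g'(t) = h(t). At m = 0 the quotient is 0 by convention, and [deltat] discards that
   coefficient anyway. *)
pose g m := h m / m%:R.
have hg : deltat (fun m => g m * m%:R) = deltat h.
  by apply: eq_deltat => m; rewrite /g divfK // (natrS_neq0 hk).
exists g; rewrite tr_eqE; apply: Tr0_grade_sub_inv.
  by apply: lowB; [apply: low_jrep|apply: low_deltat].
have := Tr0B (Tr0B H hdiv) (grade_sub_deltat g hc).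
congr Tr0; rewrite hg [RHS]linearB /= -/KA -/KB.
by apply: serP => w; rewrite !(serDE, serNE); ring.
Qed.

End KashiwaraVergne.

Theorem theorem5p10 (k : fieldType) (hk : [pchar k] =i pred0)
  (a0 b0 : ser k) :
  tder_norm a0 b0 ->
  SolKV a0 b0 <->
  exists A B : ser k,
    tder_norm A B /\ kappa_rep a0 b0 A B /\
    seqs (ssub (sadd sx sy) (ch sy sx))
         (sadd (opsum c_one_minus_expneg (sbr sx) A)
               (opsum c_exp_minus_one (sbr sy) B)) /\
    in_delta_img (divrep A B).
Proof.
move=> [la [lb [ha hb]]].
rewrite /SolKV seqsP; split=> [[/(expder_fixed hk la lb) hc hj]|].
  exists (kappaA a0 b0), (kappaB a0 b0); split; first exact: tder_norm_kappa.
  split; first exact/kappa_repE.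
  by split; [apply/kv_equation|apply/in_delta_img_kappa].
case=> A [B [hAB [hrep [hkv hdiv]]]].
(* A normalized pair representing kappa(F) is unique, so the given pair is the explicit one. *)
have [eA eB] := kappa_unique hk la lb ha hb hAB hrep; subst A B.
move/(kv_equation hk): hkv => hc.
by split; [apply/(expder_fixed hk)|apply/(in_delta_img_kappa hk)].
Qed.
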